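(* Each operator belonging to the Loy--Willis ideal $\mathscr{M}$ of $\mathscr{B}(C_0[0,\omega_1))$ is the sum of at most three commutators. Hence a scalar-valued, linear mapping $\tau$ defined on $\mathscr{B}(C_0[0,\omega_1))$ is a trace if and only if $\tau$ is a scalar multiple of the Alspach--Benyamini character $\varphi$. In particular, each trace on $\mathscr{B}(C_0[0,\omega_1))$ is automatically continuous.
   Context: Scalars are in $\mathbb{K}=\mathbb{R}$ or $\mathbb{K}=\mathbb{C}$. $\omega_1$ is the first uncountable ordinal; ordinal intervals carry the order topology. $C_0[0,\omega_1)$ is the Banach space (supremum norm) of continuous functions $[0,\omega_1)\to\mathbb{K}$ that vanish eventually, and $\mathscr{B}(X)$ is the Banach algebra of bounded operators on $X$. The commutator of a pair of elements $a,b$ of an algebra $\mathscr{A}$ is $[a,b]=ab-ba$; here the algebra is $\mathscr{A}=\mathscr{B}(C_0[0,\omega_1))$. A trace on an algebra $\mathscr{A}$ is a scalar-valued linear mapping $\tau$ on $\mathscr{A}$ such that $\tau(ab)=\tau(ba)$ for all $a,b\in\mathscr{A}$ (no continuity is assumed). Loy--Willis ideal: every functional in $C[0,\omega_1]^*$ has a unique representation $\sum_{\gamma\le\omega_1}g(\gamma)\delta_\gamma$ with $\sum_{\gamma\le\omega_1}|g(\gamma)|<\infty$, where $\delta_\gamma$ is the point evaluation at $\gamma$. The matrix of $T\in\mathscr{B}(C[0,\omega_1])$ is defined by $T^*\delta_\beta=\sum_{\gamma\le\omega_1}T_{\beta,\gamma}\delta_\gamma$. The original Loy--Willis ideal of $\mathscr{B}(C[0,\omega_1])$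 is the set of $T$ such that the function $\beta\mapsto T_{\beta,\omega_1}$ on $[0,\omega_1]$ is continuous at $\omega_1$; it is a two-sided ideal of codimension one. The Loy--Willis ideal $\mathscr{M}$ of $\mathscr{B}(C_0[0,\omega_1))$ consists of those $T$ for which $U^{-1}TU$ belongs to the original Loy--Willis ideal, where $U$ is an isomorphism of $C[0,\omega_1]$ onto $C_0[0,\omega_1)$ (the definition is independent of the choice of $U$). Alspach--Benyamini character: for each $T\in\mathscr{B}(C_0[0,\omega_1))$, $\varphi(T)$ is the unique scalar for which there is a closed and unbounded subset $D$ of $[0,\omega_1)$ with $(Tf)(\alpha)=\varphi(T)f(\alpha)$ for all $f\in C_0[0,\omega_1)$ and $\alpha\in D$; the map $\varphi$ is a character on $\mathscr{B}(C_0[0,\omega_1))$. *)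

(* Defs.v *)
From HB Require Import structures.
From mathcomp Require Import all_boot all_order all_algebra finmap complex.
From mathcomp Require Import all_classical all_reals all_analysis.
From mathcomp Require Import summability.
From mathcomp Require wochoice.

Set Implicit Arguments.
Unset Strict Implicit.
Unset Printing Implicit Defensive.

Import Order.TTheory GRing.Theory Num.Theory.
Import numFieldNormedType.Exports.

Local Open Scope classical_set_scope.
Local Open Scope ring_scope.

Variant scalar_kind := RealScalars | ComplexScalars.

Definition scalar_field (R : realType) (k : scalar_kind) : numFieldType :=
  match k with RealScalars => R | ComplexScalars => R[i] end.

Lemma scalar_sup (R : realType) (k : scalar_kind)
    (A : set (scalar_field R k)) :
  A !=set0 -> (forall x, A x -> 0 <= x) -> (exists M, ubound A M) ->
  supremums A !=set0.
Proof.
case: k A => /= A A0 Age0 [M AM].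
  exists (sup A); split; first by apply: ub_le_sup; exists M.
  by move=> x Ax; apply: ge_sup.
pose B := (@complex.Re R) @` A.
have AE x : A x -> x = (complex.Re x)%:C%C.
  by move=> /Age0; rewrite lecE /= => /andP[/eqP]; case: x => a b /= ->.
have ME x : A x -> (complex.Re x <= complex.Re M) && (complex.Im M == 0).
  by move=> Ax; move: (AM _ Ax); rewrite {1}(AE _ Ax) lecE /= => /andP[-> ->].
have B0 : B !=set0 by case: A0 => x Ax; exists (complex.Re x), x.
have Bub : has_ubound B.
  by exists (complex.Re M) => _ [x /ME /andP[? _] <-].
exists (sup B)%:C%C; split.
  move=> x Ax; rewrite {1}(AE _ Ax) lecR.
  by apply: ub_le_sup => //; exists x.
move=> y Ay; have yI : complex.Im y = 0.
  case: A0 => x Ax; move: (Ay _ Ax).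
  by rewrite {1}(AE _ Ax) lecE /= => /andP[/eqP].
rewrite lecE /= yI eqxx /=; apply: ge_sup => // _ [x Ax <-].
by move: (Ay _ Ax); rewrite {1}(AE _ Ax) lecE /= => /andP[_].
Qed.

Section supremum_scalar.
Variables (R : realType) (k : scalar_kind).
Local Notation K := (scalar_field R k).
Variables (A : set K) (M : K).
Hypotheses (Age0 : forall x, A x -> 0 <= x) (AM : ubound A M).

Lemma supremum_scalar_ub x : A x -> x <= supremum 0 A.
Proof.
move=> Ax; rewrite /supremum; case: ifPn => [/eqP A0|_].
  by move: Ax; rewrite A0.
have [s sA] : supremums A !=set0.
  by apply: scalar_sup => //; [exists x|exists M].
by case: xgetP => [y _ [yA _]|/(_ s)//]; exact: yA.
Qed.

Lemma supremum_scalar_le y : 0 <= y -> ubound A y -> supremum 0 A <= y.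
Proof.
move=> y0 Ay; rewrite /supremum; case: ifPn => // _.
by case: xgetP => // z _ [_ zA]; exact: zA.
Qed.
End supremum_scalar.

(* A linear space of bounded functions [T -> K], to be normed by the supremum
   norm. Norms are [K]-valued: over [R[i]], [supremum] refers to the partial
   order of [R[i]], and [scalar_sup] shows that the suprema needed exist. *)
Record funspace (R : realType) (k : scalar_kind) (T : Type) := FunSpace {
  fs_pred : {pred T -> scalar_field R k} ;
  fs_submod : submod_closed fs_pred ;
  fs_bounded : forall f, f \in fs_pred -> exists M, forall x, `|f x| <= M }.

Section funspace_theory.
Variables (R : realType) (k : scalar_kind) (T : Type) (F : funspace R k T).
Local Notation K := (scalar_field R k).

HB.instance Definition _ :=
  GRing.isSubmodClosed.Build K (T -> K) (fs_pred F) (fs_submod F).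

Record fs_type := FsType { fs_fun :> T -> K ; fs_funP : fs_fun \in fs_pred F }.

HB.instance Definition _ := [isSub for fs_fun].
HB.instance Definition _ := [Choice of fs_type by <:].
HB.instance Definition _ := [SubChoice_isSubLmodule of fs_type by <:].

Definition sup_norm (f : fs_type) : K := supremum 0 (range (fun x => `|f x|)).

Lemma sup_norm_ge (f : fs_type) x : `|f x| <= sup_norm f.
Proof.
have [M fM] := fs_bounded (fs_funP f).
apply: (@supremum_scalar_ub _ _ _ M); last by exists x.
  by move=> ? [y _ <-].
by move=> ? [y _ <-].
Qed.

Lemma sup_norm_le (f : fs_type) M :
  0 <= M -> (forall x, `|f x| <= M) -> sup_norm f <= M.
Proof. by move=> M0 fM; apply: supremum_scalar_le => // _ [x _ <-]. Qed.

Lemma sup_norm_ge0 (f : fs_type) : 0 <= sup_norm f.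
Proof.
have [A0|/set0P[y [x _ _]]] := eqVneq (range (fun x => `|f x|)) set0.
  by rewrite /sup_norm A0 supremum0.
exact: le_trans (sup_norm_ge f x).
Qed.

Let sup_normD (f g : fs_type) : sup_norm (f + g) <= sup_norm f + sup_norm g.
Proof.
apply: sup_norm_le => [|x]; first by rewrite addr_ge0 ?sup_norm_ge0.
by rewrite (le_trans (ler_normD _ _))// lerD ?sup_norm_ge.
Qed.

Let sup_normZ (a : K) (f : fs_type) : sup_norm (a *: f) = `|a| * sup_norm f.
Proof.
have le (b : K) (g : fs_type) : sup_norm (b *: g) <= `|b| * sup_norm g.
  apply: sup_norm_le => [|x]; first by rewrite mulr_ge0 ?sup_norm_ge0.
  by rewrite normrM ler_wpM2l ?sup_norm_ge.
have [->|a0] := eqVneq a 0.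
  rewrite normr0 mul0r scale0r; apply/eqP; rewrite eq_le sup_norm_ge0 andbT.
  by apply: sup_norm_le => // x; rewrite normr0.
apply/eqP; rewrite eq_le le /= -ler_pdivlMl ?normr_gt0//.
rewrite -normfV; apply: le_trans (le _ _).
by rewrite scalerA mulVf// scale1r.
Qed.

Let sup_norm_eq0 (f : fs_type) : sup_norm f = 0 -> f = 0.
Proof.
move=> f0; apply/val_inj/funext => x /=.
by apply/eqP; rewrite -normr_le0 -f0 sup_norm_ge.
Qed.

HB.instance Definition _ :=
  @Lmodule_isNormed.Build K fs_type sup_norm sup_normD sup_normZ sup_norm_eq0.

Lemma fsDE (f g : fs_type) x : (f + g) x = f x + g x. Proof. by []. Qed.
Lemma fsZE (a : K) (f : fs_type) x : (a *: f) x = a * f x. Proof. by []. Qed.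

End funspace_theory.

Definition bounded_linear (K : numFieldType) (V W : normedModType K) :
    {pred V -> W} :=
  [pred f | `[< linear f /\ exists M, forall x, `|f x| <= M * `|x| >]].

Section bounded_operators.
Variables (R : realType) (k : scalar_kind).
Local Notation K := (scalar_field R k).
Section VW.
Variables (V W : normedModType K).

Lemma bounded_linearP (f : V -> W) :
  reflect (linear f /\ exists M, forall x, `|f x| <= M * `|x|)
          (f \in @bounded_linear K V W).
Proof. by apply: (iffP idP) => [/asboolP|?] //; apply/asboolP. Qed.

Lemma bounded_linear_submod : submod_closed (@bounded_linear K V W).
Proof.
split.
  apply/bounded_linearP; split => [a u v|]; first by rewrite scaler0 addr0.
  by exists 0 => x; rewrite normr0 mul0r.
move=> a f g /bounded_linearP[fl [M fM]] /bounded_linearP[gl [N gN]].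
apply/bounded_linearP; split => [b u v|].
  rewrite -![(_ + _ : V -> W) _]/(_ + _) -![(_ *: _ : V -> W) _]/(_ *: _).
  by rewrite fl gl !scalerDr !scalerA [b * a]mulrC addrACA.
exists (`|a| * M + N) => x.
rewrite mulrDl (le_trans (ler_normD _ _))// lerD// -mulrA normrZ.
by rewrite ler_wpM2l.
Qed.

HB.instance Definition _ :=
  GRing.isSubmodClosed.Build K (V -> W) (@bounded_linear K V W)
    bounded_linear_submod.

Record bop := BOp { bop_fun :> V -> W ; bopP : bop_fun \in @bounded_linear K V W }.

HB.instance Definition _ := [isSub for bop_fun].
HB.instance Definition _ := [Choice of bop by <:].
HB.instance Definition _ := [SubChoice_isSubLmodule of bop by <:].

Lemma bop_linear (S : bop) : linear S.
Proof. by have /bounded_linearP[] := bopP S. Qed.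

HB.instance Definition _ (S : bop) :=
  GRing.isLinear.Build K V W *:%R S (bop_linear S).

Definition op_norm (S : bop) : K :=
  supremum 0 [set `|S x| | x in [set x | `|x| <= 1]].

Let op_norm_ub (S : bop) : exists M,
  ubound [set `|S x| | x in [set x | `|x| <= 1]] M.
Proof.
have /bounded_linearP[_ [M SM]] := bopP S.
exists `|M| => _ [x /= x1 <-]; apply: (le_trans (SM x)).
have [x0|x0] := eqVneq `|x| 0; first by rewrite x0 mulr0.
have Mr : 0 <= M.
  by rewrite -(pmulr_lge0 _ (_ : 0 < `|x|)) ?lt_def ?x0 ?normr_ge0// (le_trans _ (SM x)).
by rewrite ger0_norm// ler_piMr.
Qed.

Lemma op_norm_ge1 (S : bop) x : `|x| <= 1 -> `|S x| <= op_norm S.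
Proof.
move=> x1; have [M SM] := op_norm_ub S.
apply: (supremum_scalar_ub _ SM); last by exists x.
by move=> _ [y _ <-].
Qed.

Lemma op_norm_le (S : bop) M :
  0 <= M -> (forall x, `|x| <= 1 -> `|S x| <= M) -> op_norm S <= M.
Proof.
by move=> M0 SM; apply: supremum_scalar_le => // _ [x x1 <-]; exact: SM.
Qed.

Lemma op_norm_ge0 (S : bop) : 0 <= op_norm S.
Proof. by rewrite (le_trans _ (op_norm_ge1 S (_ : `|0| <= 1))) ?normr0. Qed.

Lemma op_norm_ge (S : bop) x : `|S x| <= op_norm S * `|x|.
Proof.
have [->|x0] := eqVneq x 0; first by rewrite linear0 !normr0 mulr0.
rewrite -ler_pdivrMr ?normr_gt0// mulrC.
have -> : `|x|^-1 * `|S x| = `|S (`|x|^-1 *: x)|.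
  by rewrite linearZ /= normrZ normfV normr_id.
by apply: op_norm_ge1; rewrite normrZ normfV normr_id mulVf ?normr_eq0.
Qed.

Let op_normD (S T : bop) : op_norm (S + T) <= op_norm S + op_norm T.
Proof.
apply: op_norm_le => [|x x1]; first by rewrite addr_ge0 ?op_norm_ge0.
by rewrite (le_trans (ler_normD _ _))// lerD ?op_norm_ge1.
Qed.

Let op_normZ (a : K) (S : bop) : op_norm (a *: S) = `|a| * op_norm S.
Proof.
have le (b : K) (T : bop) : op_norm (b *: T) <= `|b| * op_norm T.
  apply: op_norm_le => [|x x1]; first by rewrite mulr_ge0 ?op_norm_ge0.
  by rewrite normrZ ler_wpM2l ?op_norm_ge1.
have [->|a0] := eqVneq a 0.
  rewrite normr0 mul0r scale0r; apply/eqP; rewrite eq_le op_norm_ge0 andbT.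
  by apply: op_norm_le => // x _; rewrite normr0.
apply/eqP; rewrite eq_le le /= -ler_pdivlMl ?normr_gt0//.
rewrite -normfV; apply: le_trans (le _ _).
by rewrite scalerA mulVf// scale1r.
Qed.

Let op_norm_eq0 (S : bop) : op_norm S = 0 -> S = 0.
Proof.
move=> S0; apply/val_inj/funext => x /=.
by apply/eqP; rewrite -normr_le0 (le_trans (op_norm_ge S x))// S0 mul0r.
Qed.

HB.instance Definition _ :=
  @Lmodule_isNormed.Build K bop op_norm op_normD op_normZ op_norm_eq0.

Lemma bopDE (S T : bop) x : (S + T) x = S x + T x. Proof. by []. Qed.
Lemma bopZE (a : K) (S : bop) x : (a *: S) x = a *: S x. Proof. by []. Qed.

End VW.

Lemma bop_comp_subproof (U V W : normedModType K) (S : bop V W) (T : bop U V) :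
  S \o T \in @bounded_linear K U W.
Proof.
apply/bounded_linearP; split => [a u v /=|]; first by rewrite !linearP.
exists (op_norm S * op_norm T) => x /=.
by rewrite (le_trans (op_norm_ge _ _))// -mulrA ler_wpM2l ?op_norm_ge0 ?op_norm_ge.
Qed.

Definition bop_comp (U V W : normedModType K) (S : bop V W) (T : bop U V) :
  bop U W := BOp (bop_comp_subproof S T).

Lemma bop_id_subproof (V : normedModType K) :
  idfun \in @bounded_linear K V V.
Proof.
by apply/bounded_linearP; split => //; exists 1 => x; rewrite mul1r.
Qed.

Definition bop_id (V : normedModType K) : bop V V := BOp (bop_id_subproof V).

Section ring.
Variable V : normedModType K.

Let compA : associative (@bop_comp V V V).
Proof. by move=> S T U; apply/val_inj. Qed.
Let comp1l : left_id (bop_id V) (@bop_comp V V V).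
Proof. by move=> S; apply/val_inj. Qed.
Let comp1r : right_id (bop_id V) (@bop_comp V V V).
Proof. by move=> S; apply/val_inj. Qed.
Let compDl : left_distributive (@bop_comp V V V) +%R.
Proof. by move=> S T U; apply/val_inj. Qed.
Let compDr : right_distributive (@bop_comp V V V) +%R.
Proof. by move=> S T U; apply/val_inj/funext => x /=; exact: linearD. Qed.

HB.instance Definition _ := GRing.Zmodule_isPzRing.Build (bop V V)
  compA comp1l comp1r compDl compDr.

Lemma bopME (S T : bop V V) x : (S * T) x = S (T x). Proof. by []. Qed.
End ring.

End bounded_operators.

Notation "''B' ( V )" := (bop V V) (at level 8, format "''B' ( V )") : type_scope.

Definition commutator (A : pzRingType) (a b : A) : A := a * b - b * a.

Definition is_trace (R : realType) (k : scalar_kind)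
    (V : normedModType (scalar_field R k)) (tau : 'B(V) -> scalar_field R k) :=
  forall S T : 'B(V), tau (S * T) = tau (T * S).

Definition well_ordered d (T : orderType d) :=
  forall A : set T, A !=set0 -> exists2 m, A m & lbound A m.

(* The ordinal interval [0, omega_1), which is determined by these properties
   up to order isomorphism; see [omega1_inhabited] for its existence. *)
Record omega1 (d : Order.disp_t) := Omega1 {
  omega1_sort :> orderTopologicalType d ;
  omega1_well_ordered : well_ordered omega1_sort ;
  omega1_uncountable : ~ countable [set: omega1_sort] ;
  omega1_segment : forall a : omega1_sort, countable [set x | (x < a)%O] }.

Lemma omega1_inhabited (d : Order.disp_t) : inhabited (omega1 d).
Proof.
pose T : choiceType := nat -> bool.
have [r r_wo] := wochoice.well_ordering_principle T.
have pP (A : set T) x : (x \in [pred x | `[< A x >]]) <-> A x.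
  by rewrite inE /=; split => [/asboolP|?]//; apply/asboolP.
have wo (A : set T) : A !=set0 -> exists2 m, A m & forall x, A x -> r m x.
  case=> a Aa; have [|m [[/pP Am mA] _]] := r_wo [pred x | `[< A x >]].
    by exists a; apply/pP.
  by exists m => // x Ax; apply: mA; apply/pP.
have r_tot : total r.
  move=> x y; have [|m /= + mxy] := wo [set z | z = x \/ z = y].
    by exists x; left.
  by case=> mE; rewrite mE in mxy; rewrite mxy ?orbT//; [right|left].
have r_refl : reflexive r by move=> x; rewrite -[r x x]orbb r_tot.
have r_anti : antisymmetric r.
  move=> x y /andP[xy yx].
  have [|m [_ uniq_m]] := r_wo [pred z | `[< z = x \/ z = y >]].
    by exists x; apply/pP; left.
  have mx : m = x.
    by apply: uniq_m; split=> [|z /pP[]->//]; apply/pP; left.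
  have my : m = y.
    by apply: uniq_m; split=> [|z /pP[]->//]; apply/pP; right.
  by rewrite -mx -my.
have r_trans : transitive r.
  move=> y x z xy yz.
  have [|m /= + mxyz] := wo [set t | [\/ t = x, t = y | t = z]].
    by exists x; constructor 1.
  case=> mE; rewrite mE in mxyz.
  - by apply: mxyz; constructor 3.
  - by rewrite (r_anti x y) // xy mxyz//; constructor 1.
  - by rewrite -(r_anti y z) // yz mxyz//; constructor 2.
pose seg x := [set y | r y x /\ y <> x].
pose S := {x : T | `[< countable (seg x) >]}.
pose leS (x y : S) := r (val x) (val y).
have leS_refl : reflexive leS by move=> x; exact: r_refl.
have leS_anti : antisymmetric leS by move=> x y /r_anti/val_inj.
have leS_trans : transitive leS by move=> y x z; exact: r_trans.
have leS_tot : total leS by move=> x y; exact: r_tot.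
pose pS : porderType d :=
  HB.pack S (Order.Le_isPOrder.Build d S leS_refl leS_anti leS_trans).
pose oS : orderType d := HB.pack S pS (Order.POrder_isTotal.Build d pS leS_tot).
have oS_wo : well_ordered oS.
  move=> A [a Aa]; have [|m [s As <-] mA] := wo [set x | exists2 s : S, A s & val s = x].
    by exists (val (a : S)); exists a.
  by exists s => // x Ax; exact: (mA (val (x : S)) (ex_intro2 _ _ (x : S) Ax erefl)).
have S_unc : ~ countable [set: S].
  move=> /countable_injP[f finj].
  have fI x y : f x = f y -> x = y by move=> fxy; apply: finj; rewrite ?inE.
  have [x0 nx0] : exists x, ~ countable (seg x).
    apply: contrapT => nex.
    have c x : `[< countable (seg x) >].
      by apply/asboolP; apply: contrapT => nx; apply: nex; exists x.
    pose g (x : T) := f (exist _ x (c x)).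
    pose D : T := fun n => `[< exists2 x, g x = n & ~~ x n >].
    have [Dn|/negP nD] := boolP (D (g D)).
      have /asboolP[x gx] := Dn; have -> : x = D by case: (fI _ _ gx).
      by rewrite Dn.
    by apply: (nD); apply/asboolP; exists D => //; apply/negP.
  have [m nm mle] := wo [set x | ~ countable (seg x)] (ex_intro _ x0 nx0).
  apply: nm; apply/countable_injP.
  have c x : seg m x -> `[< countable (seg x) >].
    move=> [xm xNm]; apply/asboolP; apply: contrapT => /mle mx.
    by apply: xNm; apply: r_anti; rewrite xm mx.
  exists (fun x => if pselect (seg m x) is left mx then f (exist _ x (c x mx)) else 0%N).
  move=> x y; rewrite !inE => mx my.
  by case: pselect => // ?; case: pselect => // ? /fI [].
constructor; apply: (@Omega1 d (order_topology oS)) => //.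
move=> a; have /asboolP/countable_injP[f finj] := valP (a : S).
apply/countable_injP; exists (fun x : S => f (val x)) => x y.
have segP (z : S) : z \in [set z : oS | (z < a)%O] -> val z \in seg (val a).
  rewrite !inE /= lt_neqAle => /andP[/eqP za zle]; split => //.
  by move=> /val_inj.
by move=> /segP xa /segP ya /(finj _ _ xa ya)/val_inj.
Qed.

(* [with_top T] adds a largest element [None] to [T]; thus [with_top omega1] is
   the ordinal interval [0, omega_1], and [None] is the ordinal omega_1. *)
Definition with_top (T : Type) : Type := option T.

Section with_top_order.
Variables (d : Order.disp_t) (T : orderType d).

Definition with_top_le (x y : with_top T) : bool :=
  match x, y with
  | _, None => true
  | None, Some _ => false
  | Some a, Some b => (a <= b)%O
  end.

Let le_refl : reflexive with_top_le.
Proof. by case=> /=. Qed.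
Let le_anti : antisymmetric with_top_le.
Proof. by case=> [a|] [b|]//= ab; rewrite (le_anti ab). Qed.
Let le_trans : transitive with_top_le.
Proof. by case=> [a|] [b|] [c|]//=; exact: le_trans. Qed.
Let le_total : total with_top_le.
Proof. by case=> [a|] [b|]//=; exact: le_total. Qed.

HB.instance Definition _ := Choice.copy (with_top T) (option T).
HB.instance Definition _ :=
  Order.Le_isPOrder.Build d (with_top T) le_refl le_anti le_trans.
HB.instance Definition _ := Order.POrder_isTotal.Build d (with_top T) le_total.
HB.instance Definition _ :=
  OrderTopological.copy (with_top T) (order_topology (with_top T)).

Lemma with_top_well_ordered : well_ordered T -> well_ordered (with_top T).
Proof.
move=> Two A [x0 Ax0].
have [[a Aa]|nA] := pselect ([set a : T | A (Some a)] !=set0).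
  have [m Am mA] := Two [set a : T | A (Some a)] (ex_intro _ a Aa).
  by exists (Some m) => // -[b|] //= Ab; exact: (mA b Ab).
exists None; last by case=> [b Ab|//]; exfalso; apply: nA; exists b.
by case: x0 Ax0 => // b Ab; exfalso; apply: nA; exists b.
Qed.

End with_top_order.

Section bounded_segments.
Variables (R : realType) (k : scalar_kind).
Local Notation K := (scalar_field R k).

Lemma well_ordered_bounded d (T : orderTopologicalType d) (f : T -> K) :
  well_ordered T -> continuous f ->
  forall a, exists M, forall x, (x <= a)%O -> `|f x| <= M.
Proof.
move=> Two fc a; apply: contrapT => na.
pose A := [set a | ~ exists M, forall x : T, (x <= a)%O -> `|f x| <= M].
have [m Am mA] := Two A (ex_intro _ a na); apply: Am.
have IH b : (b < m)%O -> exists M, forall x : T, (x <= b)%O -> `|f x| <= M.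
  by move=> bm; apply: contrapT => /mA; rewrite leNgt bm.
have : nbhs m [set x | `|f x| <= `|f m| + 1].
  have := fc m; move=> /cvgr_norm_le; apply.
  by rewrite ltrDl.
rewrite itv_nbhsE => -[[l u] [ope mi] sub].
have [lb [lbm lbP]] : exists lb : option T,
    (if lb is Some b then (b < m)%O else true) /\
    forall x, (x <= m)%O -> (if lb is Some b then (b < x)%O else true) ->
      `|f x| <= `|f m| + 1.
  have sub' x : (l <= BLeft x)%O -> (x <= m)%O -> `|f x| <= `|f m| + 1.
    move=> lx xm; apply: sub; rewrite /= itv_boundlr lx /=.
    move: mi; rewrite itv_boundlr => /andP[_]; apply: le_trans.
    by rewrite bnd_simp.
  case: l ope mi {sub} sub' => [[] b|[]].
  - by case: u => [[]|[]].
  - move=> _ + sub'; rewrite itv_boundlr bnd_simp => /andP[bm _].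
    by exists (Some b); split=> // x xm bx; apply: sub'.
  - by move=> _ _ sub'; exists None; split=> // x xm _; apply: sub'.
  - by case: u => [[]|[]].
case: lb lbm lbP => [b bm bP|_ mP]; last by exists (`|f m| + 1) => x xm; exact: mP.
have [M bM] := IH b bm; exists (M + (`|f m| + 1)) => x xm.
have M0 : 0 <= M by apply: le_trans (bM b _).
have [xb|bx] := leP x b; first by rewrite (le_trans (bM x xb))// lerDl addr_ge0.
by rewrite (le_trans (bP x xm bx))// lerDr.
Qed.
End bounded_segments.

Section spaces.
Variables (R : realType) (k : scalar_kind) (d : Order.disp_t) (W : omega1 d).
Local Notation K := (scalar_field R k).

Definition vanishes_eventually (f : W -> K) :=
  exists a : W, forall x, (a < x)%O -> f x = 0.

Definition C0_pred : {pred W -> K} :=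
  [pred f | `[< continuous f /\ vanishes_eventually f >]].

Definition C_pred : {pred with_top W -> K} := [pred f | `[< continuous f >]].

Let continuous_linear (T : topologicalType) (a : K) (f g : T -> K) :
  continuous f -> continuous g -> continuous (a *: f + g).
Proof.
move=> fc gc x; apply: (@cvgD _ K); last exact: gc.
exact: (cvgM (cvg_cst a) (fc x)).
Qed.

Lemma C0_submod : submod_closed C0_pred.
Proof.
split.
  apply/asboolP; split; first by move=> x; exact: cvg_cst.
  have [a _] : [set: W] !=set0.
    by apply/set0P/eqP => W0; apply: (@omega1_uncountable _ W); rewrite W0.
  by exists a.
move=> c f g /asboolP[fc [a fa]] /asboolP[gc [b gb]]; apply/asboolP.
split; first exact: continuous_linear.
exists (Order.max a b) => x; rewrite gt_max => /andP[ax bx].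
rewrite -[(_ + _ : W -> K) _]/(c * f x + g x).
by rewrite fa// gb// mulr0 addr0.
Qed.

Lemma C0_bounded f : f \in C0_pred -> exists M, forall x, `|f x| <= M.
Proof.
move=> /asboolP[fc [a fa]].
have [M fM] := well_ordered_bounded (@omega1_well_ordered _ W) fc a.
exists M => x; have [/fM//|/fa ->] := leP x a.
by rewrite normr0; apply: le_trans (fM a _).
Qed.

Lemma C_submod : submod_closed C_pred.
Proof.
split; first by apply/asboolP; exact: cst_continuous.
by move=> c f g /asboolP fc /asboolP gc; apply/asboolP; exact: continuous_linear.
Qed.

Lemma C_bounded f : f \in C_pred -> exists M, forall x, `|f x| <= M.
Proof.
move=> /asboolP fc.
have [M fM] := well_ordered_bounded
  (with_top_well_ordered (@omega1_well_ordered _ W)) fc None.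
by exists M => x; apply: fM; case: x.
Qed.

Definition C0_space : normedModType K :=
  fs_type (FunSpace C0_submod C0_bounded).

Definition C_space : normedModType K :=
  fs_type (FunSpace C_submod C_bounded).

(* [g] is the coefficient family of [phi], i.e. [phi] is the sum of
   [g gamma *: delta_gamma] over [gamma <= omega_1] and [g] is absolutely
   summable; sums over [0, omega_1] are limits of finite partial sums. *)
Definition represents (g : with_top W -> K) (phi : C_space -> K) :=
  (exists M, forall J : {fset with_top W},
     partial_sum (fun gamma => `|g gamma|) J <= M) /\
  forall f : C_space,
    partial_sum (fun gamma => g gamma * f gamma) @ totally --> phi f.

(* The unique coefficient family of [phi] (the default is only reached if
   there is none, which does not happen for bounded functionals). *)
Definition coefficients (phi : C_space -> K) : with_top W -> K :=
  xget (fun=> 0) [set g | represents g phi].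

Definition point_eval (beta : with_top W) : C_space -> K := fun f => f beta.

(* Row [beta] of the matrix of [T] is the coefficient family of the functional
   [T^* delta_beta], that is, of the composition of [delta_beta] with [T]. *)
Definition op_matrix (T : 'B(C_space)) (beta gamma : with_top W) : K :=
  coefficients (point_eval beta \o T) gamma.

Definition original_loy_willis_ideal : set 'B(C_space) :=
  [set T | {for None, continuous (fun beta : with_top W => op_matrix T beta None)}].

(* The original ideal transferred along an isomorphism [U] with inverse [V].
   The choice of [U] being irrelevant, membership is stated with some [U]. *)
Definition loy_willis_ideal : set 'B(C0_space) :=
  [set T | exists (U : bop C_space C0_space) (V : bop C0_space C_space),
    [/\ bop_comp V U = bop_id C_space, bop_comp U V = bop_id C0_space &
        original_loy_willis_ideal (bop_comp V (bop_comp T U))]].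

Definition club (D : set W) := closed D /\ ~ has_ubound D.

Definition is_alspach_benyamini (T : 'B(C0_space)) (c : K) :=
  exists2 D, club D &
    forall (f : C0_space) (alpha : W), D alpha -> T f alpha = c * f alpha.

(* The unique scalar satisfying [is_alspach_benyamini T]. *)
Definition alspach_benyamini (T : 'B(C0_space)) : K :=
  xget 0 [set c | is_alspach_benyamini T c].

End spaces.

(* Main.v *)
(* The values of a bounded functional on the indicators of [0, a] have bounded
   variation in a, hence are eventually constant along omega_1. So the rows of an
   operator T on C_0[0, omega_1) are countably supported, and the columns are
   because elements of C_0[0, omega_1) vanish eventually. Closing off under these
   supports gives a club D along which T acts as multiplication by a function.
   That function is continuous on D, hence eventually constant: its final value
   is phi(T). If T belongs to the Loy-Willis ideal, the last column of its matrix
   is continuous at omega_1, whereas along D it jumps by phi(T) there, so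
   phi(T) = 0.

   If phi(T) = 0, every T f vanishes on a club D. With e(x) the least point of D
   above x, f |-> f - f o e projects C_0[0, omega_1) onto the functions
   vanishing on D, i.e. onto the c_0-sum of the gaps of D. When D is closed under
   ordinal addition, the gap following (p, c] contains c + (p, c], c + c + (p, c],
   and so on, so there is room for countably many disjoint copies
   U^n U0 T V0 V^n of T; summing them exhibits T as a sum of two commutators. *)

Require Import Defs.
From mathcomp Require Import all_boot all_order all_algebra.
From mathcomp Require Import all_classical all_reals all_analysis.
From mathcomp Require Import finmap complex summability ring.

Import Order.TTheory GRing.Theory Num.Theory.
Import numFieldNormedType.Exports.

Local Open Scope classical_set_scope.
Local Open Scope ring_scope.

Set Implicit Arguments.
Unset Strict Implicit.
Unset Printing Implicit Defensive.

(** * Archimedean property and completeness of the scalars *)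

Section scalars.
Variables (R : realType) (k : scalar_kind).
Local Notation K := (scalar_field R k).

Lemma scalar_archimedean (e : K) : 0 < e -> exists n : nat, n.+1%:R^-1 < e.
Proof.
suff R_arch (r : R) : 0 < r -> exists n : nat, n.+1%:R^-1 < r.
  case: k e => /= e; first exact: R_arch.
  case: e => a b; rewrite ltcE /= => /andP[/eqP -> /R_arch[n an]].
  exists n; rewrite -[n.+1%:R](rmorph_nat (@real_complex R)) -fmorphV /=.
  by rewrite ltcR.
move=> r0; exists (Num.Def.truncn r^-1).
rewrite invf_plt ?posrE//.
by rewrite truncnS_gt.
Qed.

Lemma scalar_natr_unbounded (x : K) :
  0 <= x -> exists n : nat, x < n%:R.
Proof.
move=> x0; have [|n xn] := @scalar_archimedean (x + 1)^-1.
  by rewrite invr_gt0 ltr_wpDl.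
exists n.+1; rewrite (@lt_trans _ _ (x + 1)) ?ltrDl//.
by rewrite -ltf_pV2 ?posrE ?ltr_wpDl.
Qed.

Lemma small_eq0 (x : K) : (forall e : K, 0 < e -> `|x| <= e) -> x = 0.
Proof.
move=> xe; apply/eqP; apply: contraT => x0.
have := xe (`|x| / 2); rewrite divr_gt0 ?normr_gt0// => /(_ isT).
by rewrite ler_pdivlMr// ger_pMr ?normr_gt0// lern1.
Qed.

(** Real and imaginary parts are additive and do not increase the modulus, so the complex case
    reduces to [R]. *)
Lemma scalar_cauchy (u : nat -> K) :
  (forall e, 0 < e -> exists N, forall m n, (N <= m)%N -> (N <= n)%N ->
     `|u m - u n| <= e) ->
  exists c, forall e, 0 < e -> exists N, forall n, (N <= n)%N -> `|u n - c| <= e.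
Proof.
suff R_complete (v : nat -> R) :
    (forall e, 0 < e -> exists N, forall m n, (N <= m)%N -> (N <= n)%N ->
       `|v m - v n| <= e) ->
    exists c, forall e, 0 < e ->
      exists N, forall n, (N <= n)%N -> `|v n - c| <= e.
  case: k u => /= u uC; first exact: R_complete.
  have part (p : R[i] -> R) : (forall z, (`|p z|)%:C%C <= `|z|) ->
      (forall z w, p (z - w) = p z - p w) ->
      exists c, forall e, 0 < e ->
        exists N, forall n, (N <= n)%N -> `|p (u n) - c| <= e.
    move=> p_le pB; apply: R_complete => e e0.
    have [|N uN] := uC e%:C%C; first by rewrite ltcR.
    exists N => m n Nm Nn; rewrite -lecR -pB.
    exact: le_trans (p_le _) (uN _ _ Nm Nn).
  have [|[]//|a ua] := part (@complex.Re R).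
    by move=> [x y]; rewrite normc_def lecR /= -sqrtr_sqr ler_wsqrtr// lerDl sqr_ge0.
    by move=> ? ? [].
  have [|[]//|b ub] := part (@complex.Im R).
    by move=> [x y]; rewrite normc_def lecR /= -sqrtr_sqr ler_wsqrtr// lerDr sqr_ge0.
    by move=> ? ? [].
  exists (Complex a b) => e e0.
  have eE : e = (complex.Re e)%:C%C.
    by move: e0; case: e => x y; rewrite ltcE /= => /andP[/eqP ->].
  have e2 : 0 < complex.Re e / 2 by rewrite divr_gt0// -ltcR -eE.
  have [N1 h1] := ua _ e2; have [N2 h2] := ub _ e2.
  exists (maxn N1 N2) => n; rewrite geq_max => /andP[/h1 n1 /h2 n2].
  have -> : u n - Complex a b =
      Complex (complex.Re (u n) - a) 0 + Complex 0 (complex.Im (u n) - b).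
    by case: (u n) => x y; apply/eqP; rewrite eq_complex /= addr0 add0r !eqxx.
  rewrite (le_trans (ler_normD _ _))// eE [complex.Re e]splitr rmorphD lerD//.
    by rewrite normc_def /= expr0n addr0 sqrtr_sqr lecR.
  by rewrite normc_def /= expr0n add0r sqrtr_sqr lecR.
move=> vC.
have : cvgn v.
  apply/cauchy_cvgP/cauchy_exP => e e0.
  have [|N vN] := vC (e / 2); first by rewrite divr_gt0.
  exists (v N); exists N => // n /= Nn.
  by rewrite /ball /= (le_lt_trans (vN _ _ _ Nn))// ltr_pdivrMr// ltr_pMr// ltr1n.
move=> /cvg_ex[c vc]; exists c => e e0.
have /cvgrPdist_le/(_ _ e0)[N _ NP] := vc.
by exists N => n Nn; rewrite distrC NP.
Qed.

End scalars.

(** * The order topology of well-ordered sets *)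

Section left_bounds.
Variables (d : Order.disp_t) (T : orderType d).

(* Left endpoints of the intervals [(L, x]]; [None] stands for minus infinity. *)
Definition lto (L : option T) (x : T) : bool :=
  if L is Some a then (a < x)%O else true.

Definition leo (L L' : option T) : bool :=
  if L is Some a then (if L' is Some b then (a <= b)%O else false) else true.

Lemma leo_refl L : leo L L. Proof. by case: L => //= a. Qed.

Lemma leo_total L L' : leo L L' \/ leo L' L.
Proof.
by case: L L' => [a|] [b|] /=; (try by left); (try by right); apply/orP/le_total.
Qed.

Lemma leo_trans L M N : leo L M -> leo M N -> leo L N.
Proof. by case: L M N => [a|] [b|] [c|]//=; exact: le_trans. Qed.

Lemma lto_le L x y : lto L x -> (x <= y)%O -> lto L y.
Proof. by case: L => //= a; exact: lt_le_trans. Qed.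

Lemma leo_lto L L' x : leo L L' -> lto L' x -> lto L x.
Proof. by case: L L' => [a|] [b|]//=; exact: le_lt_trans. Qed.

End left_bounds.

Section well_orders.
Variables (d : Order.disp_t) (T : orderTopologicalType d).
Hypothesis wo : well_ordered T.

Lemma wo_ind (P : T -> Prop) :
  (forall x, (forall y, (y < x)%O -> P y) -> P x) -> forall x, P x.
Proof.
move=> IH x; apply: contrapT => nPx.
have [m nPm mP] := wo (ex_intro (fun x => ~ P x) x nPx).
apply: nPm; apply: IH => y ym; apply: contrapT => /mP.
by rewrite leNgt ym.
Qed.

Definition wmin (P : T -> Prop) (H : exists x, P x) : T :=
  sval (cid2 (wo H)).

Lemma wminP P H : P (@wmin P H).
Proof. by rewrite /wmin; case: cid2. Qed.

Lemma wmin_le P H x : P x -> (@wmin P H <= x)%O.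
Proof. by rewrite /wmin; case: cid2 => m /= _; exact. Qed.

(** Only the left side matters: what lies above [x] is cut off at the successor of [x], if there is
    one, so [(L, x]] is open. *)
Lemma nbhs_wo (x : T) (A : set T) : nbhs x A <->
  exists2 L, lto L x & forall z, (z <= x)%O -> lto L z -> A z.
Proof.
split.
  rewrite itv_nbhsE => -[[l u] [ope xi] sub].
  have sub' z : (l <= BLeft z)%O -> (z <= x)%O -> A z.
    move=> lz zx; apply: sub; rewrite /= itv_boundlr lz /=.
    move: xi; rewrite itv_boundlr => /andP[_]; apply: le_trans.
    by rewrite bnd_simp.
  case: l ope xi {sub} sub' => [[] b|[]].
  - by case: u => [[]|[]].
  - move=> _ + sub'; rewrite itv_boundlr bnd_simp => /andP[bx _].
    by exists (Some b) => //= z zx bz; apply: sub'.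
  - by move=> _ _ sub'; exists None => // z zx _; apply: sub'.
  - by case: u => [[]|[]].
move=> [L Lx LA]; rewrite itv_nbhsE.
pose l : itv_bound T := if L is Some a then BRight a else -oo%O.
have lP z : (l <= BLeft z)%O = lto L z by rewrite /l /lto; case: (L).
have [nx|/forallNP nx] := pselect (exists y, (x < y)%O).
  pose y := wmin nx; have xy : (x < y)%O := wminP nx.
  exists (Interval l (BLeft y)).
    split; first by rewrite /l; case: (L).
    by rewrite /= itv_boundlr lP Lx bnd_simp.
  move=> z; rewrite /= itv_boundlr lP bnd_simp => /andP[Lz zy].
  by apply: LA => //; rewrite leNgt; apply/negP => /(wmin_le nx); rewrite leNgt zy.
exists (Interval l +oo%O).
  split; first by rewrite /l; case: (L).
  by rewrite /= itv_boundlr lP Lx.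
move=> z; rewrite /= itv_boundlr lP => /andP[Lz _].
by apply: LA => //; rewrite leNgt; apply/negP/nx.
Qed.

Lemma closed_woP (D : set T) : closed D <->
  forall x, (forall L, lto L x -> exists y, [/\ D y, lto L y & (y <= x)%O]) -> D x.
Proof.
split=> [Dc x xD|Dc x xD]; first apply: Dc.
  move=> A /nbhs_wo[L Lx LA]; have [y [Dy Ly yx]] := xD L Lx.
  by exists y; split => //; exact: LA.
apply: Dc => L Lx.
have [|y [Dy [Ly yx]]] := xD [set y | lto L y /\ (y <= x)%O].
  by apply/nbhs_wo; exists L.
by exists y.
Qed.

Lemma continuous_woP (K : numFieldType) (f : T -> K) : continuous f <->
  forall x e, 0 < e ->
    exists2 L, lto L x & forall z, (z <= x)%O -> lto L z -> `|f x - f z| <= e.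
Proof.
split=> fc x; last first.
  apply/(@cvgrPdist_le K K) => e e0; have [L Lx Lf] := fc x e e0.
  by apply/nbhs_wo; exists L.
by move=> e e0; have /(@cvgrPdist_le K K)/(_ _ e0)/nbhs_wo := fc x.
Qed.

Lemma incr_continuous (h : T -> T) : {homo h : x y / (x <= y)%O} ->
  (forall x l, (l < h x)%O ->
     exists2 L, lto L x & forall z, (z <= x)%O -> lto L z -> (l < h z)%O) ->
  continuous h.
Proof.
move=> hle hc x A /nbhs_wo[[l|] /= lx lA]; apply/nbhs_wo.
  have [L Lx Lh] := hc x l lx.
  by exists L => // z zx Lz; apply: lA; [exact: hle|exact: Lh].
by exists None => // z zx _; apply: lA => //; exact: hle.
Qed.

Lemma adjoint_homo (g h : T -> T) :
  (forall x y, (g x <= y)%O = (x <= h y)%O) -> {homo g : x y / (x <= y)%O}.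
Proof. by move=> gh x y xy; rewrite gh (le_trans xy)// -gh. Qed.

(** The adjunction turns [l < g z] into [h l < z], which holds on a left neighbourhood. *)
Lemma adjoint_continuous (g h : T -> T) :
  (forall x y, (g x <= y)%O = (x <= h y)%O) -> continuous g.
Proof.
move=> gh; apply: incr_continuous (adjoint_homo gh) _ => x l.
rewrite ltNge gh -ltNge => lx; exists (Some (h l)) => // z _ /= lz.
by rewrite ltNge gh -ltNge.
Qed.

End well_orders.

(** * Countable bounds and closed unbounded sets in $[0, \omega_1)$ *)

Section omega1_theory.
Variables (d : Order.disp_t) (W : omega1 d).
Let wo := @omega1_well_ordered d W.

Lemma omega1_ge_countable (x : W) : countable [set y | (y <= x)%O].
Proof.
have -> : [set y | (y <= x)%O] = [set y | (y < x)%O] `|` [set x].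
  apply/seteqP; split=> y /=; rewrite le_eqVlt.
    by case/orP => [/eqP ->|]; [right|left].
  by case=> [->|->]; rewrite ?eqxx ?orbT.
rewrite -bigcup2E; apply: bigcup_countable => // -[|[|n]] _ //=.
exact: omega1_segment.
Qed.

Lemma countable_bounded (A : set W) :
  countable A -> exists b, forall x, A x -> (x < b)%O.
Proof.
move=> cA; apply: contrapT => nb; apply: (@omega1_uncountable _ W).
apply: (@sub_countable _ _ _ (\bigcup_(x in A) [set y | (y <= x)%O])).
  apply: subset_card_le => y _; apply: contrapT => ny; apply: nb.
  exists y => x Ax; rewrite ltNge; apply/negP => yx; apply: ny.
  by exists x.
by apply: bigcup_countable => // x _; exact: omega1_ge_countable.
Qed.

Lemma sequence_bounded (u : nat -> W) : exists b, forall n, (u n < b)%O.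
Proof.
have [|b ub] := @countable_bounded (range u).
  by apply: sub_countable (card_image_le _ _) _.
by exists b => n; apply: ub; exists n.
Qed.

Lemma segment_image_bounded (u : W -> W) (x : W) :
  exists b, forall y, (y <= x)%O -> (u y < b)%O.
Proof.
have [|b ub] := @countable_bounded (u @` [set y | (y <= x)%O]).
  exact: sub_countable (card_image_le _ _) (omega1_ge_countable x).
by exists b => y yx; apply: ub; exists y.
Qed.

Lemma exists_gt (x : W) : exists y, (x < y)%O.
Proof.
by have [b /(_ x (lexx x)) xb] := segment_image_bounded id x; exists b.
Qed.

Definition wsucc (x : W) : W := wmin wo (exists_gt x).

Lemma lt_wsucc x : (x < wsucc x)%O. Proof. exact: (wminP wo (exists_gt x)). Qed.

Lemma omega1_inh : exists x : W, True.
Proof.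
have /set0P[x _] : [set: W] != set0 by
  apply/eqP => W0; apply: (@omega1_uncountable _ W); rewrite W0.
by exists x.
Qed.

Definition w0 : W := wmin wo omega1_inh.

Lemma w0_le x : (w0 <= x)%O. Proof. exact: (wmin_le wo omega1_inh). Qed.

Lemma lto_gt (L : option W) (x : W) : (w0 < x)%O -> lto L x ->
  exists2 a, (a < x)%O & leo L (Some a).
Proof. by case: L => [a|] x0 /= ax; [exists a|exists w0]. Qed.

Lemma club_gt (D : set W) : club D -> forall a, exists2 x, D x & (a < x)%O.
Proof.
move=> [_ Du] a; apply: contrapT => na; apply: Du; exists a => x Dx.
by rewrite leNgt; apply/negP => ax; apply: na; exists x.
Qed.

Lemma club_lim (D : set W) x : club D -> (w0 < x)%O ->
  (forall a, (a < x)%O -> exists2 y, D y & (a < y <= x)%O) -> D x.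
Proof.
move=> [/(closed_woP wo) Dc _] x0 xD; apply: Dc => L /(lto_gt x0)[a ax La].
have [y Dy /andP[ay yx]] := xD a ax.
by exists y; split => //; exact: leo_lto La _.
Qed.

(** Closing-off arguments below amount to a choice of [G]. The least point satisfies the closure
    condition vacuously and is excluded, so that left neighbourhoods of members have endpoints in
    [W]. *)
Definition stable (G : W -> W -> W) : set W :=
  [set x | (w0 < x)%O /\ forall a b, (a < x)%O -> (b < x)%O -> (G a b < x)%O].

(** For unboundedness, pass repeatedly to a bound of the countably many values of [G] so far; the
    supremum of the resulting sequence is closed under [G]. *)
Lemma stable_club G : club (stable G).
Proof.
split.
  apply/(closed_woP wo) => x xG; have [|y [[y0 _] _ yx]] := xG None; first by [].
  split=> [|a b ax bx]; first exact: lt_le_trans yx.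
  have [|z [[_ Gz] /= mz zx]] := xG (Some (Order.max a b)).
    by rewrite /= gt_max ax.
  by move: mz; rewrite gt_max => /andP[az bz]; apply: lt_le_trans zx; exact: Gz.
have bound x : exists y, (x < y)%O /\ forall a b, (a <= x)%O -> (b <= x)%O -> (G a b < y)%O.
  have h a : exists y, forall b, (b <= x)%O -> (G a b < y)%O.
    exact: segment_image_bounded.
  have [y yP] := segment_image_bounded (fun a => sval (cid (h a))) x.
  have [z yz] := exists_gt (Order.max x y); exists z.
  move: yz; rewrite gt_max => /andP[xz yz]; split=> // a b ax bx.
  apply: lt_trans (svalP (cid (h a)) b bx) _.
  by apply: lt_trans (yP a ax) yz.
move=> [a aub]; pose f x := sval (cid (bound x)).
have fP x := svalP (cid (bound x)).
pose u n := iter n f a.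
have uS n : (u n < u n.+1)%O by have [] := fP (u n).
have [b ub] := sequence_bounded u.
have Hu := ex_intro (fun b => forall n, (u n < b)%O) b ub.
pose m := wmin wo Hu.
have um n : (u n < m)%O by exact: (wminP wo Hu n).
have below c : (c < m)%O -> exists n, (c <= u n)%O.
  move=> cm; apply: contrapT => /forallNP nc.
  have : (m <= c)%O.
    by apply: (wmin_le wo Hu) => n; rewrite ltNge; apply/negP/nc.
  by rewrite leNgt cm.
have u_le : {homo u : i j / (i <= j)%N >-> (i <= j)%O}.
  by apply: homo_leq => // [x y z|n]; [exact: le_trans|exact: ltW].
have : (m <= a)%O.
  apply: aub; split=> [|x y xm ym]; first exact: le_lt_trans (w0_le _) (um 0%N).
  have [i xi] := below _ xm; have [j yj] := below _ ym.
  have [_ /(_ x y)] := fP (u (maxn i j)).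
  rewrite (le_trans xi) ?(le_trans yj) ?u_le ?leq_maxl ?leq_maxr//.
  by move=> /(_ isT isT) h; apply: lt_trans h (um (maxn i j).+1).
by rewrite leNgt (um 0%N).
Qed.

Definition club_next (D : set W) (Dc : club D) (a : W) : W :=
  sval (cid2 (club_gt Dc a)).

Lemma club_nextP D (Dc : club D) a : D (club_next Dc a).
Proof. by rewrite /club_next; case: cid2. Qed.

Lemma lt_club_next D (Dc : club D) a : (a < club_next Dc a)%O.
Proof. by rewrite /club_next; case: cid2. Qed.

(** [G a a] dominates a point of [D] above [a], so closure points of [G] are limits of points of
    [D]. *)
Lemma stable_sub_club D (Dc : club D) G :
  (forall a, (club_next Dc a <= G a a)%O) -> stable G `<=` D.
Proof.
move=> GD x [x0 Gx]; apply: club_lim => // a ax.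
exists (club_next Dc a); first exact: club_nextP.
by rewrite lt_club_next/= ltW// (le_lt_trans (GD a))// Gx.
Qed.

Lemma clubI (D E : set W) : club D -> club E -> exists2 F, club F & F `<=` D `&` E.
Proof.
move=> Dc Ec.
exists (stable (fun a _ => Order.max (club_next Dc a) (club_next Ec a))).
  exact: stable_club.
by move=> x Fx; split; apply: (stable_sub_club (Dc := _)) Fx => a;
  rewrite le_max lexx ?orbT.
Qed.

Lemma club_tail (D : set W) a : club D -> club (D `&` [set x | (a < x)%O]).
Proof.
move=> Dc; split.
  apply/(closed_woP wo) => x xP.
  have [|y [[_ /= ay] _ yx]] := xP None; first by [].
  split; last exact: lt_le_trans yx.
  have [/(closed_woP wo) h _] := Dc; apply: h => L Lx.
  by have [z [[Dz _] Lz zx]] := xP L Lx; exists z.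
move=> [b bub]; have [x Dx] := club_gt Dc (Order.max a b).
rewrite gt_max => /andP[ax bx].
by have := bub x (conj Dx ax); rewrite leNgt bx.
Qed.

End omega1_theory.

(** * Ordinal sums and the gaps of a club *)

Section ordinal_sum.
Variables (d : Order.disp_t) (W : omega1 d).
Let wo := @omega1_well_ordered d W.

Lemma omega1_wf : well_founded (fun x y : W => (x < y)%O).
Proof. by apply: (wo_ind wo) => x IH; constructor. Qed.

Lemma osum_exists (a x : W) (u : forall z, (z < x)%O -> W) :
  exists y, (a <= y)%O /\ forall z zx, (u z zx < y)%O.
Proof.
pose v z := if pselect (z < x)%O is left h then u z h else w0 W.
have [b bv] := segment_image_bounded v x.
exists (Order.max a b); split=> [|z zx]; first by rewrite le_max lexx.
rewrite lt_max; have := bv z (ltW zx); rewrite /v; case: pselect => // h.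
by rewrite (bool_irrelevance h zx) => ->; rewrite orbT.
Qed.

(* The ordinal sum [a + x]; equivalently, [osum a] is the increasing
   enumeration of the final segment [[a, omega_1)]. *)
Definition osum (a : W) : W -> W :=
  Fix omega1_wf (fun _ => W) (fun x u => wmin wo (@osum_exists a x u)).

Lemma osumE a x :
  osum a x = wmin wo (@osum_exists a x (fun z _ => osum a z)).
Proof.
rewrite /osum Fix_eq// => y f g fg; congr (wmin wo (osum_exists a _)).
by apply: functional_extensionality_dep => z;
  apply: functional_extensionality_dep => zy.
Qed.

Lemma osum_ge a x : (a <= osum a x)%O.
Proof. by rewrite osumE; have [] := wminP wo (@osum_exists a x (fun z _ => osum a z)). Qed.

Lemma osum_lt a : {homo osum a : x y / (x < y)%O}.
Proof.
move=> z x zx; rewrite [ltRHS]osumE.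
by have [_ /(_ z zx)] := wminP wo (@osum_exists a x (fun z _ => osum a z)).
Qed.

Lemma osum_min a x y : (a <= y)%O -> (forall z, (z < x)%O -> (osum a z < y)%O) ->
  (osum a x <= y)%O.
Proof. by move=> ay xy; rewrite osumE; apply: wmin_le. Qed.

Lemma le_osum a : {mono osum a : x y / (x <= y)%O}.
Proof. exact/le_mono/osum_lt. Qed.

Lemma osum_ge_r a x : (x <= osum a x)%O.
Proof.
elim/(wo_ind wo): x => x IH; rewrite leNgt; apply/negP => sx.
by have := IH _ sx; rewrite leNgt osum_lt.
Qed.

Lemma osum_surj a y : (a <= y)%O -> exists x, osum a x = y.
Proof.
move=> ay; have H : exists x, (y <= osum a x)%O by exists y; exact: osum_ge_r.
exists (wmin wo H); apply/eqP; rewrite eq_le (wminP wo H) andbT.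
apply: osum_min => // z zx; rewrite ltNge; apply/negP => /(wmin_le wo H).
by rewrite leNgt zx.
Qed.

Lemma odiff_exists a y : exists x, (y <= osum a x)%O.
Proof. by exists y; exact: osum_ge_r. Qed.

(* [odiff a y] is [- a + y], and [0] if [y < a]. *)
Definition odiff a y : W := wmin wo (odiff_exists a y).

(** This adjunction yields both monotonicity and continuity of [odiff a]. *)
Lemma odiff_le a y x : (odiff a y <= x)%O = (y <= osum a x)%O.
Proof.
apply/idP/idP => [yx|]; last exact: (wmin_le wo (odiff_exists a y)).
by apply: le_trans (wminP wo (odiff_exists a y)) _; rewrite le_osum.
Qed.

Lemma odiffK a : cancel (osum a) (odiff a).
Proof.
move=> x; apply/eqP; rewrite eq_le odiff_le lexx/= leNgt; apply/negP => h.
have := lexx (odiff a (osum a x)); rewrite odiff_le le_osum.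
by rewrite leNgt h.
Qed.

Lemma odiff_le_id a y : (odiff a y <= y)%O.
Proof. by rewrite odiff_le osum_ge_r. Qed.

Lemma osum_continuous a : continuous (osum a).
Proof.
apply: (incr_continuous wo) => [x y|x l lx]; first by rewrite le_osum.
have [al|al] := ltP l a.
  by exists None => // z _ _; exact: lt_le_trans (osum_ge a z).
have [y yl] := osum_surj al.
exists (Some y) => [|z _ /= yz]; last by rewrite -yl osum_lt.
by rewrite /= -(leW_mono (@le_osum a)) yl.
Qed.

Lemma odiff_continuous a : continuous (odiff a).
Proof. exact: (adjoint_continuous wo (odiff_le a)). Qed.

Lemma odiff_homo a : {homo odiff a : x y / (x <= y)%O}.
Proof. exact: adjoint_homo (odiff_le a). Qed.

End ordinal_sum.

(** * Lower adjoints of increasing surjections *)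

Section lower_adjoint.
Variables (d : Order.disp_t) (W : omega1 d) (h : W -> W).
Let wo := @omega1_well_ordered d W.
Hypothesis h_le : {homo h : x y / (x <= y)%O}.
Hypothesis h_surj : forall x, exists y, h y = x.

Lemma lower_exists x : exists y, (x <= h y)%O.
Proof. by have [y <-] := h_surj x; exists y. Qed.

(** The lower adjoint of [h]: continuous as an adjoint, and a section of [h] by surjectivity. *)
Definition lower x : W := wmin wo (lower_exists x).

Lemma lower_le x y : (lower x <= y)%O = (x <= h y)%O.
Proof.
apply/idP/idP => [xy|]; last exact: (wmin_le wo (lower_exists x)).
exact: le_trans (wminP wo (lower_exists x)) (h_le xy).
Qed.

Lemma lowerK : cancel lower h.
Proof.
move=> x; apply/eqP; rewrite eq_le -lower_le lexx andbT.
by have [y <-] := h_surj x; apply: h_le; rewrite lower_le.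
Qed.

Lemma lower_continuous : continuous lower.
Proof. exact: (adjoint_continuous wo lower_le). Qed.

End lower_adjoint.

(** * Gaps of a club whose points are closed under ordinal addition *)

Section gaps.
Variables (d : Order.disp_t) (W : omega1 d) (D : set W).
Let wo := @omega1_well_ordered d W.
Hypothesis D0 : D (w0 W).
Hypothesis Dclub : club D.
Hypothesis Dsum : forall c a b, D c -> (a < c)%O -> (b < c)%O -> (osum a b < c)%O.

Lemma gap_end_exists x : exists c, D c /\ (x <= c)%O.
Proof. by have [c Dc xc] := club_gt Dclub x; exists c; split=> //; exact: ltW. Qed.

Lemma gap_next_exists x : exists c, D c /\ (x < c)%O.
Proof. by have [c Dc xc] := club_gt Dclub x; exists c. Qed.

Lemma gap_start_exists x : exists u, forall c, D c -> (c < x)%O -> (c <= u)%O.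
Proof. by exists x => c _ /ltW. Qed.

(* [W] is the union of the intervals [(gap_start x, gap_end x]], whose right
   endpoints lie in [D]; here [gap_start x = x] if [x] is a limit point of [D]
   (or [0]). *)
Definition gap_end x : W := wmin wo (gap_end_exists x).
Definition gap_next x : W := wmin wo (gap_next_exists x).
Definition gap_start x : W := wmin wo (gap_start_exists x).

Lemma gap_endD x : D (gap_end x).
Proof. by have [] := wminP wo (gap_end_exists x). Qed.
Lemma gap_end_ge x : (x <= gap_end x)%O.
Proof. by have [] := wminP wo (gap_end_exists x). Qed.
Lemma gap_end_le x c : D c -> (x <= c)%O -> (gap_end x <= c)%O.
Proof. by move=> Dc xc; apply: wmin_le. Qed.

Lemma gap_nextD x : D (gap_next x).
Proof. by have [] := wminP wo (gap_next_exists x). Qed.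
Lemma gap_next_gt x : (x < gap_next x)%O.
Proof. by have [] := wminP wo (gap_next_exists x). Qed.
Lemma gap_next_le x c : D c -> (x < c)%O -> (gap_next x <= c)%O.
Proof. by move=> Dc xc; apply: wmin_le. Qed.

Lemma gap_start_ge x c : D c -> (c < x)%O -> (c <= gap_start x)%O.
Proof. exact: (wminP wo (gap_start_exists x)). Qed.

Lemma gap_start_le x u : (gap_start x <= u)%O = (x <= gap_next u)%O.
Proof.
apply/idP/idP => [xu|xu].
  rewrite leNgt; apply/negP => /(gap_start_ge (gap_nextD u)).
  by move=> /le_trans/(_ xu); rewrite leNgt gap_next_gt.
apply: (wmin_le wo (gap_start_exists x)) => c Dc cx; rewrite leNgt.
by apply/negP => /(gap_next_le Dc)/(le_trans xu); rewrite leNgt cx.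
Qed.

Lemma gap_start_id x : (gap_start x <= x)%O.
Proof. by rewrite gap_start_le ltW ?gap_next_gt. Qed.

Lemma gap_start_homo : {homo gap_start : x y / (x <= y)%O}.
Proof. exact: adjoint_homo gap_start_le. Qed.

Lemma gap_start_lt x a : (a < gap_start x)%O ->
  exists c, [/\ D c, (c < x)%O & (a < c)%O].
Proof.
rewrite ltNge gap_start_le -ltNge => ax; exists (gap_next a).
by split; rewrite ?gap_next_gt//; exact: gap_nextD.
Qed.

Lemma gap_startD x : D (gap_start x).
Proof.
have [->//|x0] := eqVneq (gap_start x) (w0 W).
apply: (club_lim Dclub) => [|a /gap_start_lt[c [Dc cx ac]]].
  by rewrite lt_neqAle eq_sym x0 w0_le.
by exists c => //; rewrite ac gap_start_ge.
Qed.

Lemma gap_start_const x z :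
  (gap_start x < z <= x)%O -> gap_start z = gap_start x.
Proof.
move=> /andP[xz zx]; apply/eqP; rewrite eq_le gap_start_homo//=.
exact: gap_start_ge (gap_startD x) xz.
Qed.

Lemma gap_start_limit x l : (l < gap_start x)%O ->
  exists2 L, lto L x & forall z, (z <= x)%O -> lto L z -> (l < gap_start z)%O.
Proof.
move=> /gap_start_lt[c [Dc cx lc]]; exists (Some c) => // z _ /= cz.
exact: lt_le_trans lc (gap_start_ge Dc cz).
Qed.

Lemma gap_end_homo : {homo gap_end : x y / (x <= y)%O}.
Proof.
move=> x y xy; apply: gap_end_le; first exact: gap_endD.
exact: le_trans (gap_end_ge y).
Qed.

Lemma gap_end_id c : D c -> gap_end c = c.
Proof. by move=> Dc; apply/eqP; rewrite eq_le gap_end_ge gap_end_le. Qed.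

Lemma gap_end_const x z : (gap_start x < z <= x)%O -> gap_end z = gap_end x.
Proof.
move=> /andP[xz zx]; apply/eqP; rewrite eq_le gap_end_homo//=.
apply: gap_end_le (gap_endD z) _; rewrite leNgt; apply/negP => zx'.
have := gap_start_ge (gap_endD z) zx'.
by rewrite leNgt (lt_le_trans xz)// gap_end_ge.
Qed.

(** For [x] outside [D] the function is constant on [(gap_start x, x]]; for [x] in [D] its value is
    [x], and [z <= gap_end z] suffices. *)
Lemma gap_end_continuous : continuous gap_end.
Proof.
apply: (incr_continuous wo) gap_end_homo _ => x l lx.
have [lx'|xl] := ltP l x.
  by exists (Some l) => // z _ /= lz; exact: lt_le_trans lz (gap_end_ge z).
have xNe : (gap_start x < x)%O.
  rewrite lt_neqAle gap_start_id andbT; apply: contraTneq lx => xE.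
  by rewrite gap_end_id -?leNgt// -xE; exact: gap_startD.
exists (Some (gap_start x)) => // z zx /= xz.
by rewrite (@gap_end_const x)// xz zx.
Qed.

Lemma osum_gap_le c x : D c -> (x <= gap_next c)%O -> (osum c x <= gap_next c)%O.
Proof.
move=> Dc xc; apply: osum_min => [|z zx]; first exact/ltW/gap_next_gt.
by apply: Dsum; [exact: gap_nextD|exact: gap_next_gt|exact: lt_le_trans xc].
Qed.

Lemma gap_next_start x : (x <= gap_next (gap_start x))%O.
Proof. by rewrite -gap_start_le. Qed.

Lemma gap_start_osum c x : D c -> (c < osum c x)%O -> (x <= gap_next c)%O ->
  gap_start (osum c x) = c.
Proof.
move=> Dc cx xc; apply/eqP; rewrite eq_le gap_start_le gap_start_ge// andbT.
exact: osum_gap_le.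
Qed.

Lemma gap_next_lt x y : (gap_start x < gap_start y)%O ->
  (gap_next (gap_start x) <= gap_start y)%O.
Proof. exact: gap_next_le (gap_startD y). Qed.

(* For consecutive points [p < c < c'] of [D], the set [(c, c']] splits into
   [(c, c + c]], which contains the copy [c + (p, c]] of the preceding gap, and
   [(c + c, c']], which is a copy [c + (c, c']] of the whole gap. The map
   [gap_shift] undoes the second embedding and [gap_copy] the first;
   both collapse the remaining points to [D]. *)
Definition gap_shift y : W :=
  Order.max (gap_start y) (odiff (gap_start y) y).
Definition gap_copy y : W :=
  Order.min (gap_start y)
    (Order.max (gap_start (gap_start y)) (odiff (gap_start y) y)).

(** Within a gap [odiff] is increasing; across gaps, the point of [D] closing the earlier gap
    separates the values. *)
Lemma gap_shift_homo : {homo gap_shift : x y / (x <= y)%O}.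
Proof.
move=> x y xy; have := gap_start_homo xy; rewrite le_eqVlt => /predU1P[E|lt].
  by rewrite /gap_shift E ge_max !le_max lexx odiff_homo ?orbT.
rewrite (@le_trans _ _ (gap_start y))//; last by rewrite le_max lexx.
rewrite (le_trans _ (gap_next_lt lt))// ge_max ltW ?gap_next_gt//.
by rewrite (le_trans (odiff_le_id _ _))// gap_next_start.
Qed.

Lemma gap_copy_homo : {homo gap_copy : x y / (x <= y)%O}.
Proof.
move=> x y xy; have := gap_start_homo xy; rewrite le_eqVlt => /predU1P[E|lt].
  rewrite /gap_copy E le_min ge_min lexx/= ge_min; apply/orP; right.
  by rewrite ge_max !le_max lexx odiff_homo ?orbT.
have xy' := gap_start_ge (gap_startD x) lt.
by rewrite le_min !ge_min ltW//= le_max xy'.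
Qed.

(** A point [c] of [D] is closed under addition, hence [- p + c = c] for every [p < c]. *)
Lemma gap_shiftD c : D c -> gap_shift c = c.
Proof.
move=> Dc; apply/eqP; rewrite eq_le ge_max gap_start_id odiff_le_id/= le_max.
have [//|lt] := leP c (gap_start c).
rewrite leNgt; apply/negP => oc; have := lexx (odiff (gap_start c) c).
by rewrite odiff_le leNgt Dsum.
Qed.

Lemma gap_copyD c : D c -> D (gap_copy c).
Proof.
move=> Dc; have -> : gap_copy c = gap_start c; last exact: gap_startD.
apply/min_idPl; rewrite le_max; have [cs|lt] := leP c (gap_start c).
  have -> : gap_start c = c by apply/eqP; rewrite eq_le gap_start_id.
  by rewrite cs.
have := gap_shiftD Dc; rewrite /gap_shift.
have [_ _|_ E] := leP (gap_start c) (odiff (gap_start c) c); first by rewrite orbT.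
by rewrite E ltxx in lt.
Qed.

(** With [c = gap_start y], the gap is cut at [c + c]: up to there [gap_shift] collapses to [D],
    beyond it [gap_copy] does. This keeps the copies of an operator disjoint. *)
Lemma gap_copy_or_shiftD y : D (gap_copy y) \/ D (gap_shift y).
Proof.
have [le|lt] := leP (odiff (gap_start y) y) (gap_start y).
  by right; rewrite /gap_shift; move/max_idPl: le => ->; exact: gap_startD.
left; have -> : gap_copy y = gap_start y; last exact: gap_startD.
by apply/min_idPl; rewrite le_max (ltW lt) orbT.
Qed.

Lemma gap_shift_surj x : exists y, gap_shift y = x.
Proof.
have [sx|sx] := leP x (gap_start x).
  have xs : gap_start x = x by apply/eqP; rewrite eq_le gap_start_id.
  by exists x; apply: gap_shiftD; rewrite -xs; exact: gap_startD.
have lt : (gap_start x < osum (gap_start x) x)%O.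
  exact: lt_le_trans (osum_ge_r _ _).
exists (osum (gap_start x) x).
rewrite /gap_shift gap_start_osum ?gap_next_start//; last exact: gap_startD.
by rewrite odiffK; apply/max_idPr/ltW.
Qed.

(** Unless [gap_start x = x], a preimage is [c + x], where [c] ends the gap of [x]: since
    [gap_start c < x <= c], the truncations in [gap_copy] leave [x] unchanged. *)
Lemma gap_copy_surj x : exists y, gap_copy y = x.
Proof.
have [sx|sx] := leP x (gap_start x).
  have xs : gap_start x = x by apply/eqP; rewrite eq_le gap_start_id.
  exists x; rewrite /gap_copy !xs; apply/min_idPl; by rewrite le_max lexx.
have x0 : (w0 W < x)%O by apply: le_lt_trans (w0_le _) sx.
set c := gap_end x; have Dc : D c := gap_endD x.
have cs : gap_start c = gap_start x.
  apply/eqP; rewrite eq_le (gap_start_homo (gap_end_ge x)) andbT.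
  rewrite leNgt; apply/negP => /gap_start_lt[b [Db bc xb]].
  have bx : (b < x)%O.
    by rewrite ltNge; apply/negP => /(gap_end_le Db); rewrite leNgt bc.
  by have := gap_start_ge Db bx; rewrite leNgt xb.
have lt : (c < osum c x)%O.
  apply: le_lt_trans (osum_lt c x0); exact: osum_ge.
exists (osum c x); rewrite /gap_copy gap_start_osum//.
  rewrite odiffK cs; move/ltW/max_idPr: sx => ->.
  exact/min_idPr/gap_end_ge.
exact: le_trans (gap_end_ge x) (ltW (gap_next_gt _)).
Qed.

Lemma odiff_gap_limit x l : (l < odiff (gap_start x) x)%O ->
  exists2 L, lto L x & forall z, (z <= x)%O -> lto L z ->
    gap_start z = gap_start x /\ (l < odiff (gap_start x) z)%O.
Proof.
rewrite ltNge odiff_le -ltNge => lx.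
exists (Some (osum (gap_start x) l)) => // z zx /= lz; split.
  apply: gap_start_const; rewrite zx andbT.
  exact: le_lt_trans (osum_ge _ _) lz.
by rewrite ltNge odiff_le -ltNge.
Qed.

Lemma gap_shift_continuous : continuous gap_shift.
Proof.
apply: (incr_continuous wo) gap_shift_homo _ => x l; rewrite lt_max => /orP[lx|lx].
  have [L Lx LP] := gap_start_limit lx; exists L => // z zx Lz.
  by rewrite lt_max LP.
have [L Lx LP] := odiff_gap_limit lx; exists L => // z zx Lz.
by have [zs lz] := LP z zx Lz; rewrite /gap_shift zs lt_max lz orbT.
Qed.

Lemma gap_copy_continuous : continuous gap_copy.
Proof.
apply: (incr_continuous wo) gap_copy_homo _ => x l.
rewrite lt_min lt_max => /andP[ls /orP[lx|lx]].
  have [c [Dc cx lc]] := gap_start_lt lx.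
  have cx' : (c < x)%O by apply: lt_le_trans cx (gap_start_id x).
  (* A second point of [D] is needed because the lower bound for [gap_copy z] is
     [gap_start (gap_start z)], which goes back through [D] twice. *)
  have [b [Db bx cb]] : exists b, [/\ D b, (b < x)%O & (c < b)%O].
    apply: gap_start_lt; exact: cx.
  exists (Some b) => // z _ /= bz.
  have bs : (b <= gap_start z)%O := gap_start_ge Db bz.
  have cs : (c <= gap_start (gap_start z))%O.
    by apply: gap_start_ge Dc _; exact: lt_le_trans bs.
  rewrite lt_min lt_max (lt_le_trans lc cs) andbT.
  exact: lt_le_trans (lt_trans lc cb) bs.
have [L Lx LP] := odiff_gap_limit lx; exists L => // z zx Lz.
by have [zs lz] := LP z zx Lz; rewrite /gap_copy zs lt_min ls lt_max lz orbT.
Qed.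

End gaps.

(** * Functionals on spaces of bounded functions *)

Section bounded_operators.
Variables (R : realType) (k : scalar_kind).
Local Notation K := (scalar_field R k).
Variables V V' : normedModType K.

Definition mkbop (f : V -> V') (fl : linear f) (M : K)
  (fM : forall x, `|f x| <= M * `|x|) : bop V V' :=
  BOp (introT (bounded_linearP f) (conj fl (ex_intro _ M fM))).

Lemma bop_ext (S T : bop V V') : S =1 T -> S = T.
Proof. by move=> ST; apply/val_inj/funext. Qed.

Lemma small_mul_eq0 (M x : K) :
  0 <= M -> (forall e, 0 < e -> `|x| <= M * e) -> x = 0.
Proof.
move=> M0 xM; apply: small_eq0 => e e0.
rewrite (le_trans (xM (e / (M + 1)) _))//; first by rewrite divr_gt0 ?ltr_wpDl.
by rewrite mulrCA ger_pMr// ler_pdivrMr ?ltr_wpDl// mul1r lerDl.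
Qed.

End bounded_operators.

(** * Bounded functionals and indicators of initial segments *)

Section initial_segments.
Variables (R : realType) (k : scalar_kind) (d : Order.disp_t).
Variable T : orderTopologicalType d.
Hypothesis wo : well_ordered T.
Local Notation K := (scalar_field R k).

Definition cutf (a : T) (f : T -> K) (x : T) : K := if (x <= a)%O then f x else 0.

Lemma cutf_continuous a f : continuous f -> continuous (cutf a f).
Proof.
move=> /(continuous_woP wo) fc; apply/(continuous_woP wo) => x e e0.
have [xa|ax] := leP x a.
  have [L Lx LP] := fc x e e0; exists L => // z zx Lz.
  by rewrite /cutf xa (le_trans zx xa) LP.
exists (Some a) => // z zx /= az.
by rewrite /cutf !leNgt ax az/= subrr normr0 ltW.
Qed.

Variable F : funspace R k T.
Hypothesis F_continuous : forall f, f \in fs_pred F -> continuous f.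
Hypothesis F_cut : forall a f, continuous f -> cutf a f \in fs_pred F.
Local Notation V := (fs_type F).

Lemma fs_ext (f g : V) : f =1 g -> f = g.
Proof. by move=> fg; apply/val_inj/funext. Qed.

Lemma fs_le (f : V) x : `|f x| <= `|f|.
Proof. exact: sup_norm_ge. Qed.

Lemma fs_norm_le (f : V) M : 0 <= M -> (forall x, `|f x| <= M) -> `|f| <= M.
Proof. exact: sup_norm_le. Qed.

Lemma fs_continuous (f : V) : continuous f.
Proof. exact: F_continuous (fs_funP f). Qed.

Definition cut_fs a (f : V) : V := FsType (F_cut a (fs_continuous (f:=f))).

Lemma cut_linear a : linear (cut_fs a).
Proof.
move=> c f g; apply: fs_ext => x; rewrite fsDE fsZE /= /cutf.
by case: ifP => // _; rewrite mulr0 addr0.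
Qed.

Lemma cut_bound a f : `|cut_fs a f| <= 1 * `|f|.
Proof.
rewrite mul1r; apply: fs_norm_le => // x; rewrite /= /cutf.
by case: ifP => _; rewrite ?fs_le// normr0.
Qed.

Definition cutop a : 'B(V) := mkbop (cut_linear a) (cut_bound a).

Lemma cutopE a (f : V) x : cutop a f x = if (x <= a)%O then f x else 0.
Proof. by []. Qed.

Definition indle a : V := FsType (F_cut a (@cst_continuous T K 1)).

Lemma indleE a x : indle a x = if (x <= a)%O then 1 else 0.
Proof. by []. Qed.

Lemma indle_norm a : `|indle a| <= 1.
Proof. by apply: fs_norm_le => // x; rewrite indleE; case: ifP; rewrite ?normr1 ?normr0. Qed.

Section functional.
Variables (mu : V -> K) (M : K).
Hypothesis mu_linear : linear mu.
Hypothesis M_ge0 : 0 <= M.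
Hypothesis mu_bound : forall f, `|mu f| <= M * `|f|.

Let muD f g : mu (f + g) = mu f + mu g.
Proof. by have := mu_linear 1 f g; rewrite scale1r /GRing.scale /= mul1r. Qed.
Let mu0 : mu 0 = 0.
Proof. by apply: (addrI (mu 0)); rewrite -muD !addr0. Qed.
Let muZ c f : mu (c *: f) = c * mu f.
Proof. by have := mu_linear c f 0; rewrite mu0 !addr0. Qed.
Let muB f g : mu (f - g) = mu f - mu g.
Proof. by rewrite muD -scaleN1r muZ mulN1r. Qed.

(** If all increments exceeded [e], the first [n] interval indicators, with unimodular coefficients,
    would sum to a function of norm at most 1, the intervals being disjoint, on which [mu] is at
    least [n * e]. *)
Lemma bounded_variation (u v : nat -> T) (e : K) :
  (forall n, (u n <= v n)%O) -> (forall n, (v n <= u n.+1)%O) -> 0 < e ->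
  exists n, `|mu (indle (v n)) - mu (indle (u n))| <= e.
Proof.
move=> uv vu e0; apply: contrapT => /forallNP nP.
pose w n := indle (v n) - indle (u n).
pose t n : K := `|mu (w n)| / mu (w n).
have wE n x : w n x = if (u n < x <= v n)%O then 1 else 0.
  rewrite [LHS](_ : _ = indle (v n) x - indle (u n) x)// !indleE.
  have [xu|ux] := leP x (u n); last by rewrite subr0.
  by rewrite (le_trans xu (uv n)) subrr.
have wP n : e < `|mu (w n)|.
  rewrite real_ltNge ?normr_real ?(gtr0_real e0)//.
  by apply/negP; rewrite muB; exact: nP.
have muw0 : forall n, mu (w n) != 0.
  by move=> i; rewrite -normr_gt0 (lt_trans e0 (wP i)).
have t1 n : `|t n| = 1.
  by rewrite /t normf_div normr_id divff ?normr_eq0.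
pose f n := \sum_(i < n) t i *: w i.
have fS n x : f n.+1 x = f n x + t n * w n x.
  by rewrite /f big_ord_recr.
have f0 x : f 0%N x = 0 by rewrite /f big_ord0.
have fP n x : `|f n x| <= 1 /\ ((u n < x)%O -> f n x = 0).
  elim: n => [|n [IH1 IH2]]; first by rewrite f0 normr0 ler01.
  rewrite fS wE; split.
    have [ux|xu] /= := ltP (u n) x; last by rewrite mulr0 addr0.
    rewrite IH2// add0r; case: ifP => _; last by rewrite mulr0 normr0.
    by rewrite mulr1 t1.
  move=> ux; have vx := le_lt_trans (vu n) ux.
  by rewrite IH2 ?(le_lt_trans (uv n) vx)// leNgt vx andbF mulr0 addr0.
have muf n : mu (f n) = \sum_(i < n) `|mu (w i)|.
  elim: n => [|n IH]; first by rewrite /f !big_ord0 mu0.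
  by rewrite /f !big_ord_recr muD -/(f n) IH muZ /t divfK ?muw0.
have fM n : n%:R * e <= M.
  rewrite (le_trans (_ : _ <= mu (f n)))//.
    rewrite muf -[n in n%:R]card_ord mulr_natl -sumr_const ler_sum// => i _.
    exact/ltW/wP.
  rewrite -[leLHS]ger0_norm ?muf ?sumr_ge0// -muf.
  rewrite (le_trans (mu_bound _))// ler_piMr// fs_norm_le// => x.
  by have [] := fP n x.
have [n] := @scalar_natr_unbounded R k (M / e) (divr_ge0 M_ge0 (ltW e0)).
by rewrite ltr_pdivrMr// => /lt_le_trans/(_ (fM n)); rewrite ltxx.
Qed.

(** Otherwise successive intervals with increments above [e] could be chosen forever, against
    [bounded_variation]. Restricting right endpoints by [Q] covers limits at omega_1 as well as left
    limits at a point. *)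
Lemma vanishing_tail (Q : T -> Prop) (e : K) : 0 < e ->
  exists2 L, (forall l, L = Some l -> Q l) &
    forall a b, leo L (Some a) -> (a <= b)%O -> Q b ->
      `|mu (indle b) - mu (indle a)| <= e.
Proof.
move=> e0; apply: contrapT => nP.
have step (L : option T) : exists p : T * T, (forall l, L = Some l -> Q l) ->
    [/\ leo L (Some p.1), (p.1 <= p.2)%O, Q p.2 &
        ~ `|mu (indle p.2) - mu (indle p.1)| <= e].
  (* Where [Q] fails at [L] any pair will do; this makes the choice function total. *)
  have [QL|nQL] := pselect (forall l, L = Some l -> Q l); last first.
    have [x|nT] := pselect (exists x : T, True).
      by case: x => x _; exists (x, x).
    case: nP; exists None => // a; by case: nT; exists a.
  apply: contrapT => /forallNP np; apply: nP; exists L => // a b La ab Qb.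
  by apply: contrapT => nab; apply: (np (a, b)) => _; split.
pose g L := sval (cid (step L)).
have gP L := svalP (cid (step L)).
pose p n := iter n (fun q => g (Some q.2)) (g None).
have pP n : [/\ (p n).1 <= (p n).2, Q (p n).2 &
    ~ `|mu (indle (p n).2) - mu (indle (p n).1)| <= e]%O.
  elim: n => [|n [_ Qn _]]; first by have [] := gP None.
  have [|] := gP (Some (p n).2); [by move=> l [<-]|by []].
have pS n : ((p n).2 <= (p n.+1).1)%O.
  have [_ Qn _] := pP n.
  by have [|] := gP (Some (p n).2); [by move=> l [<-]|].
have [|n] := @bounded_variation (fun n => (p n).1) (fun n => (p n).2) e _ pS e0.
  by move=> n; have [] := pP n.
by have [_ _] := pP n.
Qed.

(** Transfinite induction on [a]: on some [(L, a]] the function is within [e] of the constant [f a],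
    whose indicator [mu] kills, and the part up to [L] is covered by induction. *)
Lemma functional_eq0 : (forall a, mu (indle a) = 0) ->
  forall (f : V) a, cutop a f = f -> mu f = 0.
Proof.
move=> mu1 f a <-; elim/(wo_ind wo): a => a IH.
apply: (small_mul_eq0 M_ge0) => e e0.
have /(continuous_woP wo)/(_ a e e0)[L La LP] := fs_continuous (f:=f).
pose g := cutop a f - f a *: indle a.
have gE x : g x = if (x <= a)%O then f x - f a else 0.
  rewrite /g fsDE -scaleNr fsZE indleE cutopE mulNr.
  by case: ifP => _; rewrite ?mulr1 // mulr0 subr0.
have gmu : mu g = mu (cutop a f) by rewrite muB muZ mu1 mulr0 subr0.
have cutg l : (l < a)%O -> cutop l g = cutop l f - f a *: indle l.
  move=> la; apply: fs_ext => x; rewrite cutopE gE fsDE -scaleNr fsZE indleE cutopE.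
  have [xl|xl] := leP x l; last by rewrite mulr0 addr0.
  by rewrite (le_trans xl (ltW la)) mulr1.
have -> : mu (cutop a f) = mu (if L is Some l then g - cutop l g else g).
  case: L La {LP} => [l|] La; last by rewrite gmu.
  by rewrite muB gmu (cutg l La) muB muZ mu1 (IH l La) mulr0 !subr0.
rewrite (le_trans (mu_bound _))// ler_wpM2l// fs_norm_le ?ltW// => x.
case: L La LP => [l /= la|_] LP; last first.
  by rewrite gE; have [xa|_] := leP x a; [by rewrite distrC LP|by rewrite normr0 ltW].
rewrite -[X in `|X|]/(g x - cutop l g x) cutopE.
have [xl|lx] := leP x l; first by rewrite subrr normr0 ltW.
by rewrite subr0 gE; have [xa|_] := leP x a; [by rewrite distrC LP|by rewrite normr0 ltW].
Qed.

End functional.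
End initial_segments.

(** * The Alspach--Benyamini character *)

Section C0.
Variables (R : realType) (k : scalar_kind) (d : Order.disp_t) (W : omega1 d).
Local Notation K := (scalar_field R k).
Local Notation X := (C0_space R k W).
Let wo := @omega1_well_ordered d W.

Lemma C0_continuous (f : W -> K) :
  f \in fs_pred (FunSpace (@C0_submod R k d W) (@C0_bounded R k d W)) ->
  continuous f.
Proof. by move=> /asboolP[]. Qed.

Lemma C0_cut a (f : W -> K) : continuous f ->
  cutf a f \in fs_pred (FunSpace (@C0_submod R k d W) (@C0_bounded R k d W)).
Proof.
move=> fc; apply/asboolP; split; first exact: (cutf_continuous wo).
by exists a => x ax; rewrite /cutf leNgt ax.
Qed.

Lemma C0_vanish (f : X) : exists a, forall x, (a < x)%O -> f x = 0.
Proof. by have /asboolP[] := fs_funP f. Qed.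

Lemma C0_ext (f g : X) : f =1 g -> f = g.
Proof. exact: fs_ext. Qed.

Definition cut0 a : 'B(X) := cutop C0_continuous C0_cut a.
Definition one0 a : X := indle C0_cut a.

Lemma cut0E a (f : X) x : cut0 a f x = if (x <= a)%O then f x else 0.
Proof. by []. Qed.

Lemma one0E a x : one0 a x = if (x <= a)%O then 1 else 0.
Proof. by []. Qed.

Lemma one0_norm a : `|one0 a| <= 1.
Proof. exact: indle_norm. Qed.

Lemma cut0_one a b : cut0 a (one0 b) = one0 (Order.min a b).
Proof.
apply: C0_ext => x; rewrite cut0E !one0E le_min.
by case: leP => //.
Qed.

Lemma cut0_id a (f : X) : (forall x, (a < x)%O -> f x = 0) -> cut0 a f = f.
Proof. by move=> fa; apply: C0_ext => x; rewrite cut0E; case: leP => // /fa. Qed.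

Lemma C0D (f g : X) x : (f + g) x = f x + g x. Proof. by []. Qed.
Lemma C0Z (a : K) (f : X) x : (a *: f) x = a * f x. Proof. by []. Qed.
Lemma C0B (f g : X) x : (f - g) x = f x - g x. Proof. by []. Qed.

Lemma C0_continuousP (f : X) x e : 0 < e ->
  exists2 L, lto L x & forall z, (z <= x)%O -> lto L z -> `|f x - f z| <= e.
Proof.
by have /asboolP[/(continuous_woP wo) fc _] := fs_funP f; exact: fc.
Qed.

Lemma C0_functional_eq0 (mu : X -> K) (M : K) : linear mu -> 0 <= M ->
  (forall f, `|mu f| <= M * `|f|) -> (forall a, mu (one0 a) = 0) ->
  forall f, mu f = 0.
Proof.
move=> mul M0 muM mu1 f; have [a fa] := C0_vanish f.
exact: (functional_eq0 wo mul M0 muM mu1 (cut0_id fa)).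
Qed.

(** * Countable supports and the diagonal of an operator *)

Section rows_and_columns.
Variable T : 'B(X).

Lemma row_linear y : linear (fun f : X => T f y : K).
Proof. by move=> c f g; rewrite linearP. Qed.

Lemma row_bound y (f : X) : `|T f y| <= op_norm T * `|f|.
Proof. exact: le_trans (fs_le _ y) (op_norm_ge T f). Qed.

(** The countably many functions [T (one0 c)], [c <= a], vanish beyond a common point, and
    functionals are determined by indicators. *)
Lemma column_support a : exists b, forall f : X,
  (forall x, (a < x)%O -> f x = 0) -> forall y, (b < y)%O -> T f y = 0.
Proof.
pose v c := sval (cid (C0_vanish (T (one0 c)))).
have vP c := svalP (cid (C0_vanish (T (one0 c)))).
have [b bv] := segment_image_bounded v a.
exists b => f fa y yb; rewrite -(cut0_id fa).
apply: (@C0_functional_eq0 (fun g => T (cut0 a g) y) (op_norm T)).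
- by move=> c g h; rewrite !linearP.
- exact: op_norm_ge0.
- move=> g; rewrite (le_trans (row_bound _ _))// ler_wpM2l ?op_norm_ge0//.
  by have := cut_bound C0_continuous C0_cut a g; rewrite mul1r.
- move=> c; rewrite cut0_one; apply: vP.
  by apply: lt_trans yb; apply: bv; rewrite ge_min lexx.
Qed.

(** Beyond [l n] the values [T (one0 a) y] vary by at most [1/(n+1)], so they are constant beyond a
    bound [b] of all [l n]; then [f - cut0 b f] is killed for every indicator [f]. *)
Lemma row_support y : exists b, forall f : X,
  (forall x, (x <= b)%O -> f x = 0) -> T f y = 0.
Proof.
have tail n : exists l : W, forall a b, (l <= a)%O -> (a <= b)%O ->
    `|T (one0 b) y - T (one0 a) y| <= n.+1%:R^-1.
  have n0 : 0 < n.+1%:R^-1 :> K by rewrite invr_gt0 ltr0n.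
  have [L _ LP] := @vanishing_tail R k d W _ C0_cut
    _ _ (row_linear y) (op_norm_ge0 T) (row_bound y) (fun=> True) _ n0.
  exists (if L is Some l then l else w0 W) => a b la ab.
  by apply: LP => //; case: L la.
pose l n := sval (cid (tail n)); have lP n := svalP (cid (tail n)).
have [b lb] := sequence_bounded l; exists b => f fb.
have -> : f = f - cut0 b f.
  by apply: C0_ext => x; rewrite C0B cut0E; case: leP => [/fb ->|_]; rewrite subr0.
apply: (@C0_functional_eq0 (fun g => T (g - cut0 b g) y) (op_norm T * 2)).
- move=> c g h; rewrite linearP opprD addrACA -scalerBr linearP.
  by [].
- by rewrite mulr_ge0 ?op_norm_ge0.
- move=> g; rewrite (le_trans (row_bound _ _))// -mulrA ler_wpM2l ?op_norm_ge0//.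
  rewrite (le_trans (ler_normB _ _))// mulr_natl mulr2n lerD2l.
  by have := cut_bound C0_continuous C0_cut b g; rewrite mul1r.
- move=> a; rewrite cut0_one linearB C0B.
  have [ba|ab] := leP b a; last by rewrite subrr.
  apply: small_eq0 => e e0; have [n ne] := scalar_archimedean e0.
  rewrite (le_trans _ (ltW ne))// lP//.
  exact/ltW/lb.
Qed.

Definition row_column_bound (a _ : W) : W :=
  Order.max (wsucc a) (Order.max (sval (cid (column_support a)))
                                 (sval (cid (row_support a)))).

Let S := stable row_column_bound.

(** Cut [f] at some [a < c] and at [c]. Column bounds dispose of the part up to [a], row bounds of
    the part beyond [c]; the middle part is small since [f] is continuous and [f c = 0]. *)
Lemma row_diagonal c (f : X) : S c -> f c = 0 -> T f c = 0.
Proof.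
move=> [c0 cS] fc; apply: (small_mul_eq0 (op_norm_ge0 T)) => e e0.
have bounds a : (a < c)%O -> [/\ (wsucc a < c)%O,
    (sval (cid (column_support a)) < c)%O & (sval (cid (row_support a)) < c)%O].
  by move=> ac; have := cS a a ac ac; rewrite !gt_max => /andP[-> /andP[-> ->]].
have [L Lc LP] := C0_continuousP f c e0.
have [a ac La] := lto_gt c0 Lc; have [_ ca _] := bounds a ac.
have Tlow : T (cut0 a f) c = 0.
  apply: (svalP (cid (column_support a))) ca => x ax.
  by rewrite cut0E leNgt ax.
have Thigh : T (f - cut0 c f) c = 0.
  (* The support of row [c] itself may reach beyond [c]; rows [b < c] are used instead, and
     continuity at [c], a limit because of [wsucc], gives the value there. *)
  have Thigh b : (b < c)%O -> T (f - cut0 c f) b = 0.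
    move=> bc; apply: (svalP (cid (row_support b))) => x xb.
    have [_ _ /ltW/(le_trans xb) xc] := bounds b bc.
    by rewrite C0B cut0E xc subrr.
  apply: small_eq0 => e' e'0.
  have [L' L'c L'P] := C0_continuousP (T (f - cut0 c f)) c e'0.
  have [b bc L'b] := lto_gt c0 L'c; have [sc _ _] := bounds b bc.
  have := L'P _ (ltW sc); rewrite (Thigh _ sc) subr0; apply.
  exact: leo_lto L'b (lt_wsucc b).
have -> : T f c = T (cut0 c f - cut0 a f) c.
  rewrite [in LHS](_ : f = (f - cut0 c f) + (cut0 c f - cut0 a f) + cut0 a f).
    by rewrite 2!linearD 2!C0D Thigh Tlow add0r addr0.
  by rewrite -addrA !subrK.
rewrite (le_trans (row_bound _ _))// ler_wpM2l ?op_norm_ge0//.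
apply: fs_norm_le => [|x]; first exact: ltW.
have [xa|ax] := leP x a.
  by rewrite C0B !cut0E xa (le_trans xa (ltW ac)) subrr normr0 ltW.
rewrite C0B !cut0E [(x <= a)%O]leNgt ax subr0; have [xc|_] := leP x c.
  have := LP x xc (leo_lto La ax).
  by rewrite fc sub0r normrN.
by rewrite normr0 ltW.
Qed.

Let diag c : K := T (one0 c) c.

Lemma row_diagonalE c (f : X) : S c -> T f c = f c * diag c.
Proof.
move=> Sc; apply/eqP; rewrite -subr_eq0; apply/eqP.
have : T (f - f c *: one0 c) c = 0.
  by apply: row_diagonal => //; rewrite C0B C0Z one0E lexx mulr1 subrr.
by rewrite linearB linearZ.
Qed.

(** Otherwise close off under a choice of bad pairs. Such pairs lie arbitrarily close below a
    closure point [c], yet on the points of [S] up to [c] the diagonal agrees with [T (one0 c)],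
    which is continuous. *)
Lemma diag_tail (e : K) : 0 < e -> exists a, forall b c, S b -> S c ->
  (a < b)%O -> (a < c)%O -> `|diag b - diag c| <= e.
Proof.
move=> e0; apply: contrapT => /forallNP na.
have wit a : exists p : W * W, [/\ S p.1, S p.2, (a < p.1)%O, (a < p.2)%O &
    ~ `|diag p.1 - diag p.2| <= e].
  apply: contrapT => /forallNP np; apply: (na a) => b c Sb Sc ab ac.
  by apply: contrapT => nbc; apply: (np (b, c)); split.
pose H a := sval (cid (wit a)); have HP a := svalP (cid (wit a)).
pose G a b := Order.max (row_column_bound a b) (Order.max (H a).1 (H a).2).
have [c [c0 Gc] _] := club_gt (stable_club G) (w0 W).
have Sc : S c.
  by split=> // a b ac bc; have := Gc a b ac bc; rewrite gt_max => /andP[].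
have e2 : 0 < e / 2 by rewrite divr_gt0.
have [L Lc LP] := C0_continuousP (T (one0 c)) c e2.
have [a ac La] := lto_gt c0 Lc.
have := Gc a a ac ac; rewrite !gt_max => /andP[_ /andP[H1 H2]].
have [S1 S2 a1 a2] := HP a; apply; rewrite -/(H a).
have near b : S b -> (b < c)%O -> (a < b)%O -> `|diag c - diag b| <= e / 2.
  move=> Sb bc ab; have := LP b (ltW bc) (leo_lto La ab).
  by rewrite (row_diagonalE _ Sb) one0E (ltW bc) mul1r.
rewrite -(subrKA (diag c)) (le_trans (ler_normD _ _))// [e]splitr lerD//.
  by rewrite distrC near.
by rewrite near.
Qed.

Lemma alspach_benyamini_exists : exists c, is_alspach_benyamini T c.
Proof.
have tail n : exists a, forall b c, S b -> S c ->
    (a < b)%O -> (a < c)%O -> `|diag b - diag c| <= n.+1%:R^-1.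
  by apply: diag_tail; rewrite invr_gt0 ltr0n.
pose l n := sval (cid (tail n)); have lP n := svalP (cid (tail n)).
have [a la] := sequence_bounded l.
have [c Sc ac] := club_gt (stable_club row_column_bound) a.
exists (diag c), (S `&` [set x | (a < x)%O]).
  exact/club_tail/stable_club.
move=> f b [Sb /= ab]; rewrite row_diagonalE// mulrC; congr (_ * _).
apply/eqP; rewrite -subr_eq0; apply/eqP; apply: small_eq0 => e e0.
have [n ne] := scalar_archimedean e0; rewrite (le_trans _ (ltW ne))//.
by apply: lP => //; exact: lt_trans (la n) _.
Qed.

End rows_and_columns.

Lemma alspach_benyamini_uniq (T : 'B(X)) c c' :
  is_alspach_benyamini T c -> is_alspach_benyamini T c' -> c = c'.
Proof.
move=> [D Dc DT] [D' D'c D'T]; have [E Ec ED] := clubI Dc D'c.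
have [x /ED[Dx D'x] _] := club_gt Ec (w0 W).
have := DT (one0 x) x Dx.
by rewrite D'T// one0E lexx !mulr1.
Qed.

Lemma alspach_benyaminiE (T : 'B(X)) c :
  is_alspach_benyamini T c -> alspach_benyamini T = c.
Proof.
move=> Tc; apply: (alspach_benyamini_uniq _ Tc).
exact: (xgetPex 0 (ex_intro _ c Tc)).
Qed.

Lemma alspach_benyaminiP (T : 'B(X)) :
  is_alspach_benyamini T (alspach_benyamini T).
Proof.
by have [c Tc] := alspach_benyamini_exists T; rewrite (alspach_benyaminiE Tc).
Qed.

Lemma alspach_benyaminiM (S T : 'B(X)) :
  alspach_benyamini (S * T) = alspach_benyamini S * alspach_benyamini T.
Proof.
apply: alspach_benyaminiE.
have [D Dc DS] := alspach_benyaminiP S; have [E Ec ET] := alspach_benyaminiP T.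
have [F Fc FDE] := clubI Dc Ec; exists F => // f a /FDE[Da Ea].
by rewrite bopME DS// ET// mulrA.
Qed.

Lemma alspach_benyamini1 : alspach_benyamini (1 : 'B(X)) = 1.
Proof.
apply: alspach_benyaminiE; exists (stable (fun a _ => a)); first exact: stable_club.
by move=> f a _; rewrite mul1r.
Qed.

Lemma alspach_benyamini_norm (T : 'B(X)) : `|alspach_benyamini T| <= `|T|.
Proof.
have [D Dc DT] := alspach_benyaminiP T; have [x Dx _] := club_gt Dc (w0 W).
have := DT (one0 x) x Dx; rewrite one0E lexx mulr1 => <-.
by rewrite (le_trans (fs_le _ x))// op_norm_ge1// one0_norm.
Qed.

End C0.

(** * Commutators *)

Section commutators.
Variables (R : realType) (k : scalar_kind) (d : Order.disp_t) (W : omega1 d).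
Local Notation K := (scalar_field R k).
Local Notation X := (C0_space R k W).
Let wo := @omega1_well_ordered d W.

(** This says that [h] tends to omega_1, so that composition with [h] preserves eventual
    vanishing. *)
Definition unbounded (h : W -> W) := forall a, exists b, forall x, (b < x)%O -> (a < h x)%O.

Lemma incr_surj_unbounded (h : W -> W) : {homo h : x y / (x <= y)%O} ->
  (forall x, exists y, h y = x) -> unbounded h.
Proof.
move=> hle hsurj a; have [b ab] := exists_gt a.
have [y yb] := hsurj b; exists y => x /ltW/hle.
by rewrite yb; exact: lt_le_trans.
Qed.

Lemma expansive_unbounded (h : W -> W) : (forall x, x <= h x)%O -> unbounded h.
Proof. by move=> hx a; exists a => x ax; exact: lt_le_trans (hx x). Qed.

(** * Composition operators *)

Section composition.
Variables (h : W -> W) (hc : continuous h) (hu : unbounded h).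

Lemma comp_C0 (f : X) : (fun x => f (h x)) \in
  fs_pred (FunSpace (@C0_submod R k d W) (@C0_bounded R k d W)).
Proof.
apply/asboolP; split.
  have /asboolP[fc _] := fs_funP f.
  by move=> x; apply: (@continuous_comp _ _ _ h f); [exact: hc|exact: fc].
have [a fa] := C0_vanish f; have [b ab] := hu a.
by exists b => x /ab/fa.
Qed.

Definition comp_fun (f : X) : X := FsType (comp_C0 f).

Lemma comp_linear : linear comp_fun.
Proof. by move=> c f g; apply: C0_ext. Qed.

Lemma comp_bound f : `|comp_fun f| <= 1 * `|f|.
Proof. by rewrite mul1r; apply: fs_norm_le => // x; exact: (fs_le f (h x)). Qed.

Definition compop : 'B(X) := mkbop comp_linear comp_bound.

Lemma compopE (f : X) x : compop f x = f (h x). Proof. by []. Qed.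

Lemma compopX n (f : X) x : (compop ^+ n) f x = f (iter n h x).
Proof.
elim: n f x => [|n IH] f x; first by rewrite expr0.
by rewrite exprSr bopME IH compopE.
Qed.

Lemma compopX_norm n f : `|(compop ^+ n) f| <= `|f|.
Proof. by apply: fs_norm_le => // x; rewrite compopX fs_le. Qed.

End composition.

(** At each point only the term labelled by [N] can be nonzero, and the norms of the terms tend to
    0, so the partial sums converge uniformly. *)
Lemma disjoint_sum (t : nat -> 'B(X)) (C : K) (N : W -> nat) :
  (forall n (f : X) x, t n f x != 0 -> N x = n) ->
  (forall n f, `|t n f| <= C * `|f|) ->
  (forall f e, 0 < e -> exists M, forall n, (M <= n)%N -> `|t n f| <= e) ->
  exists S : 'B(X), forall (f : X) x, S f x = t (N x) f x.
Proof.
move=> tN tC t0; pose s (f : X) x : K := t (N x) f x.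
have sumE f M x : (\sum_(n < M) t n f : X) x = if (N x < M)%N then s f x else 0.
  elim: M => [|M IH]; first by rewrite big_ord0.
  rewrite big_ord_recr C0D IH [in RHS]ltnS [in RHS]leq_eqVlt -[t _]/(t M).
  have [NM|NM] := eqVneq (N x) M; first by rewrite NM ltnn add0r /s NM.
  have -> : t M f x = 0.
    by apply/eqP; apply: contraT => /tN Nx; rewrite Nx eqxx in NM.
  by rewrite addr0.
have s_C0 f : s f \in fs_pred (FunSpace (@C0_submod R k d W) (@C0_bounded R k d W)).
  apply/asboolP; split.
    apply/(continuous_woP wo) => x e e0.
    have e4 : 0 < e / 2 / 2 by rewrite !divr_gt0.
    have [M MP] := t0 f _ e4.
    have near y : `|s f y - (\sum_(n < M) t n f : X) y| <= e / 2 / 2.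
      rewrite sumE; case: ltnP => [_|My]; first by rewrite subrr normr0 ltW.
      by rewrite subr0 (le_trans (fs_le _ y))// MP.
    have [|L Lx LP] := C0_continuousP (\sum_(n < M) t n f : X) x (e := e / 2).
      by rewrite divr_gt0.
    exists L => // z zx Lz.
    set g := (\sum_(n < M) t n f : X) in near LP.
    have -> : s f x - s f z = (s f x - g x) + (g x - g z) - (s f z - g z) by ring.
    have eE : e = e / 2 / 2 + e / 2 + e / 2 / 2.
      by rewrite addrAC -splitr -splitr.
    rewrite [leRHS]eE (le_trans (ler_normB _ _))// lerD ?near//.
    by rewrite (le_trans (ler_normD _ _))// lerD ?near// LP.
  pose v n := sval (cid (C0_vanish (t n f))).
  have [b vb] := sequence_bounded v; exists b => x bx.
  by apply: (svalP (cid (C0_vanish (t (N x) f)))); exact: lt_trans (vb _) bx.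
have sl : linear (fun f => FsType (s_C0 f) : X).
  by move=> c f g; apply: C0_ext => x /=; rewrite /s linearP.
have sC f : `|FsType (s_C0 f) : X| <= C * `|f|.
  apply: fs_norm_le => [|x]; first exact: le_trans (tC 0%N f).
  exact: le_trans (fs_le _ x) (tC _ f).
by exists (mkbop sl sC).
Qed.

(** * Disjoint copies of an operator and the two commutators *)

Section swindle.
Variables (T : 'B(X)) (D : set W).
Hypothesis D0 : D (w0 W).
Hypothesis Dclub : club D.
Hypothesis Dsum : forall c a b, D c -> (a < c)%O -> (b < c)%O -> (osum a b < c)%O.
Hypothesis Dsucc : forall c a, D c -> (a < c)%O -> (wsucc a < c)%O.
Hypothesis TD : forall (f : X) c, D c -> (w0 W < c)%O -> T f c = 0.

Local Notation e := (gap_end Dclub).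
Local Notation rho := (gap_shift D).
Local Notation rho0 := (gap_copy D).
Local Notation sigma := (lower (gap_shift_surj D0 Dclub Dsum)).
Local Notation sigma0 := (lower (gap_copy_surj Dclub Dsum)).
Local Notation w1 := (wsucc (w0 W)).

Let rho_homo := gap_shift_homo D0 Dclub.
Let rho0_homo := gap_copy_homo D0 Dclub.

Lemma lower_unbounded (h : W -> W) (hs : forall x, exists y, h y = x) :
  {homo h : x y / (x <= y)%O} -> unbounded (lower hs).
Proof.
move=> hle a; exists (h a) => x; rewrite !ltNge; apply: contra.
by rewrite lower_le.
Qed.

(** [P = 1 - E] projects onto the functions vanishing on [D]. [V] and [B] compose with sections and
    so are left inverses of [U] and [A]. *)
Let E : 'B(X) := compop (@gap_end_continuous _ _ _ D0 Dclub)
  (expansive_unbounded (@gap_end_ge _ _ _ Dclub)).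
Let P : 'B(X) := 1 - E.
Let U : 'B(X) := compop (gap_shift_continuous D0 Dclub)
  (incr_surj_unbounded rho_homo (gap_shift_surj D0 Dclub Dsum)).
Let V : 'B(X) := compop (@lower_continuous _ _ _ rho_homo (gap_shift_surj D0 Dclub Dsum))
  (lower_unbounded (gap_shift_surj D0 Dclub Dsum) rho_homo).
Let A : 'B(X) := compop (gap_copy_continuous D0 Dclub)
  (incr_surj_unbounded rho0_homo (gap_copy_surj Dclub Dsum)).
Let B : 'B(X) := compop (@lower_continuous _ _ _ rho0_homo (gap_copy_surj Dclub Dsum))
  (lower_unbounded (gap_copy_surj Dclub Dsum) rho0_homo).
(** Translations by 1, with [S * Q = 1]. The least point lies in [D], so [P] destroys the value
    there; translating first saves it. *)
Let S : 'B(X) := compop (@osum_continuous d W w1)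
  (expansive_unbounded (osum_ge_r w1)).
Let Q : 'B(X) := compop (@odiff_continuous d W w1)
  (incr_surj_unbounded (odiff_homo w1)
     (fun x => ex_intro _ (osum w1 x) (odiffK w1 x))).

Let UE (f : X) x : U f x = f (rho x). Proof. by []. Qed.
Let VE (f : X) x : V f x = f (sigma x). Proof. by []. Qed.
Let AE (f : X) x : A f x = f (rho0 x). Proof. by []. Qed.
Let BE (f : X) x : B f x = f (sigma0 x). Proof. by []. Qed.
Let SE (f : X) x : S f x = f (osum w1 x). Proof. by []. Qed.
Let QE (f : X) x : Q f x = f (odiff w1 x). Proof. by []. Qed.

Let PE (f : X) x : P f x = f x - f (e x).
Proof. by []. Qed.

Let PD (f : X) c : D c -> P f c = 0.
Proof. by move=> Dc; rewrite PE gap_end_id// subrr. Qed.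

Let VU : V * U = 1.
Proof. by apply: bop_ext => f; apply: C0_ext => x; rewrite bopME VE UE lowerK. Qed.

Let U0 := A * P * Q.
Let V0 := S * P * B.

Let V0E (f : X) : V0 f = S (P (B f)).
Proof. by rewrite /V0 (bopME (S * P)) (bopME S). Qed.

(** What remains is [S * P * Q * T]. The value subtracted by [P] is that of [T f] at [- 1 + c] for
    some nonzero [c] in [D]; this point is [c] by additive closure, and [T f] vanishes there. *)
Let V0U0T : V0 * (U0 * T) = T.
Proof.
apply: bop_ext => f; apply: C0_ext => x.
rewrite !bopME SE PE !BE !AE !lowerK//.
rewrite [P _ (e _)]PD ?subr0; last exact: gap_endD.
rewrite PE !QE odiffK.
set c := e _; have Dc : D c := gap_endD _ _.
have w1c : (w1 <= c)%O := le_trans (osum_ge _ _) (gap_end_ge _ _).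
have c0 : (w0 W < c)%O := lt_le_trans (lt_wsucc _) w1c.
suff -> : odiff w1 c = c by rewrite (TD _ Dc c0) subr0.
apply/eqP; rewrite eq_le odiff_le_id/= leNgt; apply/negP => oc.
have := lexx (odiff w1 c); rewrite odiff_le leNgt Dsum//.
exact: Dsucc.
Qed.

Let rhoX_D n c : D c -> D (iter n rho c).
Proof. by move=> Dc; elim: n => //= n IH; rewrite gap_shiftD. Qed.

(** If stage [n] has its copy outside [D], the next [rho] lands in [D], and all later stages stay in
    [D]. *)
Let gap_copy_uniq n m x : ~ D (rho0 (iter n rho x)) -> ~ D (rho0 (iter m rho x)) -> n = m.
Proof.
wlog nm : n m / (n <= m)%N => [hw|].
  by case/orP: (leq_total n m) => ? ? ?; [|symmetry]; exact: hw.
move=> Dn Dm; move: nm; rewrite leq_eqVlt => /predU1P[//|nm]; exfalso; apply: Dm.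
apply: (gap_copyD D0 Dclub Dsum); rewrite -(subnK nm) iterD; apply: rhoX_D => /=.
by have [] := gap_copy_or_shiftD D0 Dclub (iter n rho x).
Qed.

(** The embedding onto the [n]-th copy: lower adjoint of [rho0] after [n] steps of [rho], with
    [B (V^n f)] equal to [f] after [sg n]. *)
Let sg n x := iter n sigma (sigma0 x).

Let sg_le n x y : (sg n x <= y)%O = (x <= rho0 (iter n rho y))%O.
Proof.
elim: n y => [|n IH] y; first by rewrite /sg /= lower_le.
by rewrite /sg iterS lower_le// -/(sg n x) IH iterSr.
Qed.

Let eventually_copyD l : exists N, forall n, (N <= n)%N -> D (rho0 (iter n rho l)).
Proof.
have [[m mP]|nP] := pselect (exists m, ~ D (rho0 (iter m rho l))).
  exists m.+1 => n mn; apply: contrapT => /(gap_copy_uniq mP) mE.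
  by rewrite mE ltnn in mn.
by exists 0%N => n _; apply: contrapT => nD; apply: nP; exists n.
Qed.

(** By adjunction the condition on [x] reads [x <= rho0 (iter n rho l)]. For large [n] this bound is
    in [D], hence also bounds [e x]. *)
Let sg_gap l : exists N, forall n x, (N <= n)%N ->
  (sg n x <= l)%O -> (sg n (e x) <= l)%O.
Proof.
have [N NP] := eventually_copyD l; exists N => n x /NP DN.
by rewrite !sg_le; exact: gap_end_le.
Qed.

(** Transfinite induction on a bound [a] of [sg n (e x)]. Near [a] the function is almost constant;
    if [sg n x] is at most the left endpoint [l], so is [sg n (e x)] for large [n], and induction
    applies at [l]. *)
Let oscillation (f : X) eps : 0 < eps ->
  exists N, forall n x, (N <= n)%N -> `|f (sg n x) - f (sg n (e x))| <= eps.
Proof.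
move=> e0; have e2 : 0 < eps / 2 by rewrite divr_gt0.
have sg_e n x : (sg n x <= sg n (e x))%O.
  by rewrite sg_le; apply: le_trans (@gap_end_ge _ _ _ Dclub x) _; rewrite -sg_le.
have bounded a : exists N, forall n x, (N <= n)%N -> (sg n (e x) <= a)%O ->
    `|f (sg n x) - f (sg n (e x))| <= eps.
  elim/(wo_ind wo): a => a IH.
  have [L La LP] := C0_continuousP f a e2.
  have near n x : lto L (sg n x) -> (sg n (e x) <= a)%O ->
      `|f (sg n x) - f (sg n (e x))| <= eps.
    move=> Lx xa; rewrite -(subrKA (f a)) (le_trans (ler_normD _ _))//.
    rewrite [eps]splitr lerD//; last by rewrite LP// (lto_le Lx).
    by rewrite distrC LP// (le_trans (sg_e n x)).
  case: L La {LP} near => [l la near|_ near]; last by exists 0%N => n x _; exact: near.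
  have [N1 h1] := IH l la; have [N2 h2] := sg_gap l; exists (maxn N1 N2) => n x.
  rewrite geq_max => /andP[n1 n2] xa; have [xl|lx] := leP (sg n x) l.
    by apply: h1 => //; exact: h2.
  exact: near.
have [a fa] := C0_vanish f; have [N1 h1] := bounded a; have [N2 h2] := sg_gap a.
exists (maxn N1 N2) => n x; rewrite geq_max => /andP[n1 n2].
have [xa|ax] := leP (sg n x) a; first by apply: h1 => //; exact: h2.
by rewrite !fa ?subrr ?normr0 ?ltW// (lt_le_trans ax).
Qed.

Let t n : 'B(X) := U ^+ n * (U0 * T * V0) * V ^+ n.

Let tE n (f : X) x : t n f x = U0 (T (V0 ((V ^+ n) f))) (iter n rho x).
Proof. by rewrite /t !bopME compopX. Qed.

Let t_support n (f : X) x : t n f x != 0 -> ~ D (rho0 (iter n rho x)).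
Proof.
by move=> + Dn; rewrite tE bopME bopME AE PD ?eqxx.
Qed.

Let t_bound n f : `|t n f| <= op_norm (U0 * T * V0) * `|f|.
Proof.
apply: (le_trans (compopX_norm _ _ n _)); apply: (le_trans (op_norm_ge _ _)).
by rewrite ler_wpM2l ?op_norm_ge0// compopX_norm.
Qed.

(** The factor [P] of [V0] produces exactly the differences bounded by [oscillation]. *)
Let t_lim f eps : 0 < eps -> exists M, forall n, (M <= n)%N -> `|t n f| <= eps.
Proof.
move=> e0; pose C := op_norm (U0 * T * S) + 1.
have C0 : 0 < C by rewrite ltr_wpDl// op_norm_ge0.
have [N NP] := oscillation f (divr_gt0 e0 C0); exists N => n Nn.
apply: (le_trans (compopX_norm _ _ n _)).
rewrite (bopME (U0 * T) V0) V0E -(bopME (U0 * T) S).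
apply: (le_trans (op_norm_ge _ _)).
apply: (@le_trans _ _ (C * (eps / C))); last by rewrite mulrCA divff ?mulr1 ?gt_eqF.
apply: ler_pM => //; first exact: op_norm_ge0.
  by rewrite lerDl.
apply: fs_norm_le => [|x]; first by rewrite ltW// divr_gt0.
by rewrite PE !BE !compopX; exact: NP.
Qed.

(** The sum [S'] of all copies satisfies [S' = U0 * T * V0 + U * S' * V]. Since [V0 * (U0 * T) = T]
    and [V * U = 1], this gives [T = [V0, U0 * T] + [V, U * S']]. *)
Lemma sum_of_two_commutators : exists A1 B1 A2 B2 : 'B(X),
  T = commutator A1 B1 + commutator A2 B2.
Proof.
(* The default 0 is reached only where every [t n f] vanishes. *)
pose N x := xget 0%N [set n | ~ D (rho0 (iter n rho x))].
have tN n (f : X) x : t n f x != 0 -> N x = n.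
  move=> /t_support Dn.
  have : exists m, [set m | ~ D (rho0 (iter m rho x))] m by exists n.
  by move=> /(xgetPex 0%N)/gap_copy_uniq; exact.
have [S' S'E] := disjoint_sum tN t_bound t_lim.
have tS n (f : X) x : t n.+1 f x = t n (V f) (rho x).
  by rewrite !tE exprSr bopME iterSr.
have S'_rec : S' = U0 * T * V0 + U * S' * V.
  apply: bop_ext => f; apply: C0_ext => x.
  rewrite bopDE C0D S'E [(U * S' * V) f]bopME bopME UE S'E -tS.
  have <- : t 0%N f x = (U0 * T * V0) f x by rewrite /t !expr0 mul1r mulr1.
  have [t0|t0] := eqVneq (t 0%N f x) 0.
    rewrite t0 add0r; have [tx|tx] := eqVneq (t (N x) f x) 0.
      rewrite tx; apply/esym/eqP; apply: contraT => t1.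
      by have := t1; rewrite -(tN _ _ _ t1) tx eqxx.
    case Nx : (N x) tx => [|n] tx; first by rewrite t0 eqxx in tx.
    by have := tx; rewrite tS => /tN ->.
  rewrite (tN _ _ _ t0) [X in _ + X](_ : _ = 0) ?addr0//.
  apply/eqP; apply: contraT => /tN.
  by rewrite (tN _ _ _ t0).
exists V0, (U0 * T), V, (U * S').
rewrite /commutator V0U0T (mulrA V U) VU mul1r.
by rewrite [X in _ + (X - _)]S'_rec addrK subrK.
Qed.

End swindle.
Lemma kernel_commutators (T : 'B(X)) : is_alspach_benyamini T 0 ->
  exists A1 B1 A2 B2 : 'B(X), T = commutator A1 B1 + commutator A2 B2.
Proof.
move=> [D0 D0c D0T].
pose G a b := Order.max (osum a b) (Order.max (wsucc a) (club_next D0c a)).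
(* The least point is added so that the first gap also starts in [D]; [T f] may be nonzero there. *)
pose D := [set x | x = w0 W \/ stable G x].
have DG c a b : D c -> (a < c)%O -> (b < c)%O -> (G a b < c)%O.
  by move=> [->|[_ /(_ a b)//]]; rewrite ltNge w0_le.
have Dclub : club D.
  split; last first.
    move=> [a aub]; have [x Gx ax] := club_gt (stable_club G) a.
    by have := aub x (or_intror Gx); rewrite leNgt ax.
  apply/(closed_woP wo) => x xD; have [->|x0] := eqVneq x (w0 W); first by left.
  have {}x0 : (w0 W < x)%O by rewrite lt_neqAle eq_sym x0 w0_le.
  right; apply: (club_lim (stable_club G) x0) => a ax.
  have [y [[->|Gy] /= ay yx]] := xD (Some a) ax; first by rewrite /= ltNge w0_le in ay.
  by exists y => //; rewrite ay.
apply: (@sum_of_two_commutators T D) => //.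
- by left.
- by move=> c a b Dc ac bc; have := DG c a b Dc ac bc; rewrite gt_max => /andP[].
- by move=> c a Dc ac; have := DG c a a Dc ac ac; rewrite !gt_max => /and3P[].
- move=> f c Dc c0; rewrite D0T ?mul0r//.
  apply: (stable_sub_club (Dc := D0c) (G := G)) => [a|].
    by rewrite !le_max lexx !orbT.
  by case: Dc => // cE; rewrite cE ltxx in c0.
Qed.

End commutators.

(** * Coefficients of functionals *)

Section absolutely_summable.
Variables (R : realType) (k : scalar_kind) (I : eqType).
Local Notation K := (scalar_field R k).
Variables (g : I -> K) (M : K).
Hypothesis gM : forall s : seq I, uniq s -> \sum_(i <- s) `|g i| <= M.

(** Otherwise finite sets of sum above [e], each disjoint from the earlier ones, would accumulate
    past [M]. *)
Lemma small_tail (e : K) : 0 < e -> exists s0 : seq I, forall s, uniq s ->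
  (forall i, i \in s -> i \notin s0) -> \sum_(i <- s) `|g i| <= e.
Proof.
move=> e0; apply: contrapT => /forallNP ns.
have step (s0 : seq I) : exists s : seq I, [/\ uniq s, forall i, i \in s -> i \notin s0 &
    e < \sum_(i <- s) `|g i|].
  apply: contrapT => /forallNP np; apply: (ns s0) => s su ss0.
  have sr : \sum_(i <- s) `|g i| \is Num.real by rewrite ger0_real ?sumr_ge0.
  rewrite real_leNgt ?(gtr0_real e0)//; apply/negP => es.
  by apply: (np s).
pose h s0 := sval (cid (step s0)); have hP s0 := svalP (cid (step s0)).
pose u n := iter n (fun s => h s ++ s) [::].
have uP n : uniq (u n) /\ n%:R * e <= \sum_(i <- u n) `|g i|.
  elim: n => [|n [IHu IHs]]; first by rewrite mul0r big_nil.
  have [hu hd hs] := hP (u n); split.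
    rewrite /= cat_uniq hu IHu andbT; apply/hasPn => i iu.
    by apply/negP => /hd; rewrite iu.
  by rewrite /= big_cat -natr1 mulrDl mul1r addrC lerD// ltW.
have M0 : 0 <= M by have := gM (isT : uniq [::]); rewrite big_nil.
have [n] := @scalar_natr_unbounded R k (M / e) (divr_ge0 M0 (ltW e0)).
rewrite ltr_pdivrMr// => Mn; have [un ue] := uP n.
by have := le_trans ue (gM un); move=> /(lt_le_trans Mn); rewrite ltxx.
Qed.

End absolutely_summable.

Section last_point_below.
Variables (d : Order.disp_t) (T : orderType d).

Lemma last_point_below (s : seq T) x :
  exists2 L, lto L x & forall z, z \in s -> lto L z -> (x <= z)%O.
Proof.
elim: s => [|y s [L Lx LP]]; first by exists None.
have [xy|yx] := leP x y.
  by exists L => // z; rewrite inE => /predU1P[->//|/LP]; exact.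
have [Ly|yL] := leo_total L (Some y).
  exists (Some y) => // z; rewrite inE => /predU1P[->|zs /= yz].
    by rewrite /= ltxx.
  by apply: LP => //; exact: leo_lto Ly yz.
exists L => // z; rewrite inE => /predU1P[->|/LP]; last exact.
by move=> /(leo_lto yL); rewrite /= ltxx.
Qed.

Lemma leo_max2 (L M : option T) x : lto L x -> lto M x ->
  exists2 B, lto B x & leo L B /\ leo M B.
Proof.
move=> Lx Mx; have [LM|ML] := leo_total L M.
  by exists M => //; split => //; exact: leo_refl.
by exists L => //; split => //; exact: leo_refl.
Qed.

End last_point_below.

(** * Coefficients as jumps of the functional *)

Section representation.
Variables (R : realType) (k : scalar_kind) (d : Order.disp_t).
Variable T : orderTopologicalType d.
Hypothesis wo : well_ordered T.
Local Notation K := (scalar_field R k).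
Variable F : funspace R k T.
Hypothesis F_continuous : forall f, f \in fs_pred F -> continuous f.
Hypothesis F_cut : forall a f, continuous f -> cutf a f \in fs_pred F.
Local Notation V := (fs_type F).
Local Notation ind := (indle F_cut).
Local Notation cutV := (cutop F_continuous F_cut).
Variables (mu : V -> K) (M : K).
Hypothesis mu_linear : linear mu.
Hypothesis M_ge0 : 0 <= M.
Hypothesis mu_bound : forall f, `|mu f| <= M * `|f|.

Let muD f g : mu (f + g) = mu f + mu g.
Proof. by have := mu_linear 1 f g; rewrite scale1r /GRing.scale /= mul1r. Qed.
Let mu0 : mu 0 = 0.
Proof. by apply: (addrI (mu 0)); rewrite -muD !addr0. Qed.
Let muZ c f : mu (c *: f) = c * mu f.
Proof. by have := mu_linear c f 0; rewrite mu0 !addr0. Qed.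
Let muB f g : mu (f - g) = mu f - mu g.
Proof. by rewrite muD -scaleN1r muZ mulN1r. Qed.

Let indL (L : option T) : V := if L is Some a then ind a else 0.
Let cutL (L : option T) (f : V) : V := if L is Some a then cutV a f else 0.

Let indLE L x : indL L x = if lto L x then 0 else 1.
Proof. by case: L => // a; rewrite -[LHS]/(ind a x) indleE leNgt /=; case: ltP. Qed.

Let cutLE L f x : cutL L f x = if lto L x then 0 else f x.
Proof. by case: L => // a; rewrite -[LHS]/(cutV a f x) cutopE leNgt /=; case: ltP. Qed.

Let left_cauchy x (e : K) : 0 < e -> exists2 L, lto L x & forall L1 L2,
  leo L L1 -> leo L1 L2 -> lto L2 x -> `|mu (indL L2) - mu (indL L1)| <= e.
Proof.
move=> e0; have [L LQ LP] := vanishing_tail F_cut mu_linear M_ge0 mu_bound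
  (fun y => (y < x)%O) e0.
have Lx : lto L x by case: L LQ {LP} => //= l; exact.
have Some_case a : (a < x)%O -> leo L (Some a) -> exists2 L, lto L x &
    forall L1 L2, leo L L1 -> leo L1 L2 -> lto L2 x ->
      `|mu (indL L2) - mu (indL L1)| <= e.
  move=> ax La; exists (Some a) => // -[b|//] [c|//] /= ab bc cx.
  by apply: LP => //; exact: leo_trans La _.
case: L Lx LP {LQ} Some_case => [l /= lx _|_ _] Some_case.
  exact: (Some_case l lx (lexx l)).
have [[a ax]|na] := pselect (exists a, (a < x)%O); first exact: Some_case ax _.
have nx L : lto L x -> L = None.
  by case: L => //= a ax; case: na; exists a.
exists None => // L1 L2 _ L12 L2x.
by rewrite (nx _ (leo_lto L12 L2x)) (nx _ L2x) subrr normr0 ltW.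
Qed.

(** The scalar [c] is the jump at [x] of [mu] along indicators of initial segments; it serves as the
    coefficient of the evaluation at [x]. *)
Let left_limit x : exists c : K, forall e : K, 0 < e -> exists2 L, lto L x &
  forall L', leo L L' -> lto L' x -> `|mu (ind x - indL L') - c| <= e.
Proof.
have n0 n : 0 < n.+1%:R^-1 :> K by rewrite invr_gt0 ltr0n.
pose l n := s2val (cid2 (left_cauchy x (n0 n))).
have lx n : lto (l n) x := s2valP (cid2 (left_cauchy x (n0 n))).
have lP n := s2valP' (cid2 (left_cauchy x (n0 n))).
have near m n : (leo (l m) (l n)) ->
    `|mu (indL (l n)) - mu (indL (l m))| <= m.+1%:R^-1.
  by move=> mn; apply: lP mn (lx n); exact: leo_refl.
have [|c cP] := @scalar_cauchy R k (fun n => mu (indL (l n))).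
  move=> e e0; have [N Ne] := scalar_archimedean e0; exists N => m n Nm Nn.
  have inv_le p : (N <= p)%N -> p.+1%:R^-1 <= e.
    move=> Np; rewrite (le_trans _ (ltW Ne))// lef_pV2 ?posrE ?ltr0n//.
    by rewrite ler_nat.
  (* The endpoints [l n] need not increase with [n], so they are compared directly. *)
  have [mn|nm] := leo_total (l m) (l n).
    by rewrite distrC (le_trans (near _ _ mn))// inv_le.
  by rewrite (le_trans (near _ _ nm))// inv_le.
exists (mu (ind x) - c) => e e0.
have e2 : 0 < e / 2 by rewrite divr_gt0.
have [N NP] := cP _ e2; have [p pe] := scalar_archimedean e2.
exists (l (maxn N p)) => [|L' lL' L'x]; first exact: lx.
rewrite muB (_ : _ - _ = (mu (indL (l (maxn N p))) - mu (indL L')) +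
   (c - mu (indL (l (maxn N p))))); last by ring.
rewrite (le_trans (ler_normD _ _))// [e]splitr lerD//; last first.
  by rewrite distrC NP ?leq_maxl.
rewrite distrC (le_trans (lP _ _ _ (leo_refl _) lL' L'x))//.
rewrite (le_trans _ (ltW pe))// lef_pV2 ?posrE ?ltr0n// ler_nat ltnS.
exact: leq_maxr.
Qed.

Let g x : K := sval (cid (left_limit x)).

Let gP x (e : K) : 0 < e -> exists2 L, lto L x &
  forall L', leo L L' -> lto L' x -> `|mu (ind x - indL L') - g x| <= e.
Proof. exact: (svalP (cid (left_limit x))). Qed.

(* The intervals [(L', x]] on which [mu] nearly equals [g x] can be chosen
   disjoint; [v] combines their indicators with unimodular coefficients. *)
Let g_sorted (e : K) (s : seq T) : 0 < e -> sorted (fun x y => y < x)%O s ->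
  exists v : V, [/\ forall z, `|v z| <= 1,
    forall z, (forall y, y \in s -> (y < z)%O) -> v z = 0 &
    `|mu v - \sum_(x <- s) `|g x| | <= (size s)%:R * e].
Proof.
move=> e0; elim: s => [_|x s IH]; first exists 0.
  split=> [z|//|]; first by rewrite normr0 ler01.
  by rewrite big_nil mu0 subrr normr0 mul0r.
rewrite /= => sx; have [v [v1 v0 vg]] := IH (path_sorted sx).
have xs y : y \in s -> (y < x)%O.
  move=> ys; have /allP := order_path_min (rev_trans lt_trans) sx.
  by apply.
have [L Lx LP] := gP x e0; have [L' L'x L'P] := last_point_below s x.
have [N Nx [LN L'N]] := leo_max2 Lx L'x.
pose w := ind x - indL N; pose t := `|g x| / g x.
have t1 : `|t| <= 1.
  have [gx|gx] := eqVneq (g x) 0; first by rewrite /t gx invr0 mulr0 normr0.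
  by rewrite /t normf_div normr_id divff ?normr_eq0.
have tg : t * g x = `|g x|.
  have [gx|gx] := eqVneq (g x) 0; first by rewrite gx mulr0 normr0.
  by rewrite /t divfK.
have wE z : w z = if lto N z && (z <= x)%O then 1 else 0.
  rewrite [LHS](_ : _ = ind x z - indL N z)// indLE indleE.
  have [Nz|Nz] /= := boolP (lto N z); first by rewrite subr0.
  have zx : (z <= x)%O.
    rewrite leNgt; apply: contra Nz => xz; exact: lto_le Nx (ltW xz).
  by rewrite zx subrr.
have vN z : lto N z -> v z = 0.
  move=> Nz; apply: v0 => y ys; rewrite ltNge; apply/negP => zy.
  have := L'P y ys (lto_le (leo_lto L'N Nz) zy).
  by rewrite leNgt xs.
exists (v + t *: w); split.
- move=> z; rewrite fsDE fsZE wE; have [Nz|Nz] /= := boolP (lto N z).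
    rewrite vN// add0r; case: ifP => _; first by rewrite mulr1.
    by rewrite mulr0 normr0 ler01.
  by rewrite mulr0 addr0.
- move=> z zs; have xz : (x < z)%O by apply: zs; rewrite inE eqxx.
  rewrite fsDE fsZE wE leNgt xz andbF mulr0 addr0 v0// => y ys.
  by apply: zs; rewrite inE ys orbT.
- rewrite muD muZ big_cons /= -natr1 mulrDl mul1r.
  rewrite (_ : _ - _ = (mu v - \sum_(x <- s) `|g x|) + t * (mu w - g x)); last first.
    by rewrite -tg; ring.
  rewrite (le_trans (ler_normD _ _))// lerD// normrM.
  rewrite -[leRHS]mul1r ler_pM//; exact: LP.
Qed.

Let g_bounded (s : seq T) : uniq s -> \sum_(x <- s) `|g x| <= M + 1.
Proof.
move=> su; pose s' := rev (sort <=%O s).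
have ss' : perm_eq s s' by rewrite perm_sym perm_rev perm_sort.
have s's : sorted (fun x y => y < x)%O s'.
  by rewrite rev_sorted lt_sorted_uniq_le sort_uniq su sort_le_sorted.
(* With this tolerance per point the total error is at most 1, whence the bound [M + 1]. *)
have e0 : 0 < (size s').+1%:R^-1 :> K by rewrite invr_gt0 ltr0n.
rewrite (perm_big _ ss'); have [v [v1 _ vg]] := g_sorted e0 s's.
set G := \sum_(x <- s') _ in vg *.
have G0 : 0 <= G by apply: sumr_ge0.
rewrite -(ger0_norm G0) -[G](subrK (mu v)) (le_trans (ler_normD _ _))// addrC lerD//.
  rewrite (le_trans (mu_bound _))// ler_piMr// fs_norm_le//.
rewrite distrC (le_trans vg)// ler_pdivrMr ?ltr0n// mul1r ler_nat.
exact: leqnSn.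
Qed.

(** Transfinite induction on [a]. Up to a suitable [L] induction applies; at [a] the jump [g a]
    approximates [mu] of the indicator of [(L, a]]; strictly between, the indices avoid [s1] and
    their coefficients have a small sum. *)
Let representation_upto (f : V) (a : T) (e : K) : 0 < e ->
  exists s0 : seq T, forall s, uniq s -> {subset s0 <= s} ->
    `|\sum_(x <- s | (x <= a)%O) g x * f x - mu (cutV a f)| <= e.
Proof.
elim/(wo_ind wo): a e => a IH e e0.
(* The summands cover the jump error at [a], the replacement of [f] by [f a] on [(L, a]] and the
   small coefficients; the 1 keeps [C] positive. *)
pose C := `|f| + M + `|f| + 1; have C0 : 0 < C.
  by rewrite ltr_wpDl// !addr_ge0.
pose c := e / 2 / C; have c0 : 0 < c by rewrite !divr_gt0.
have [s1 s1P] := small_tail g_bounded c0.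
have [L1 L1a L1P] := last_point_below s1 a.
have [L2 L2a L2P] := gP a c0.
have /(continuous_woP wo)/(_ a c c0)[L3 L3a L3P] := fs_continuous F_continuous (f:=f).
have [L0 L0a [L10 L20]] := leo_max2 L1a L2a.
have [L La [L0L LL3]] := leo_max2 L0a L3a.
have LL1 := leo_trans L10 L0L; have LL2 := leo_trans L20 L0L.
have {}IH : exists s0 : seq T, forall s, uniq s -> {subset s0 <= s} ->
    `|\sum_(x <- s | ~~ lto L x) g x * f x - mu (cutL L f)| <= e / 2.
  case: L La {L0L LL1 LL2 LL3} => [l la|_]; last first.
    exists [::] => s _ _; rewrite big_pred0//= mu0 subrr normr0 ltW//.
    by rewrite divr_gt0.
  have [|s0 s0P] := IH l la (e / 2); first by rewrite divr_gt0.
  exists s0 => s su ss0; have := s0P s su ss0.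
  by rewrite (eq_bigl (fun x => ~~ lto (Some l) x)) // => x /=; rewrite leNgt.
have [s2 s2P] := IH; exists (a :: s2) => s su ss.
have as_ : a \in s by apply: ss; rewrite inE eqxx.
have {}s2P := s2P s su (fun x xs => ss x (@mem_behead _ (a :: s2) x xs)).
pose q x := lto L x && (x < a)%O.
have sumE : \sum_(x <- s | (x <= a)%O) g x * f x =
    \sum_(x <- s | ~~ lto L x) g x * f x + g a * f a + \sum_(x <- s | q x) g x * f x.
  rewrite (bigID (fun x => ~~ lto L x)) /= -addrA; congr (_ + _).
    apply: eq_bigl => x; case: (boolP (lto L x)); rewrite ?andbF// andbT => Lx.
    by rewrite leNgt; apply: contra Lx => /ltW; exact: lto_le.
  rewrite big_mkcond (bigD1_seq a)//= lexx La; congr (_ + _).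
  rewrite -big_mkcondr; apply: eq_bigl => x; rewrite negbK /q lt_neqAle.
  by rewrite andbA [RHS]andbC -andbA.
pose w := ind a - indL L.
have muE : mu (cutV a f) = mu (cutL L f) + f a * mu w +
    mu (cutV a f - cutL L f - f a *: w).
  by rewrite (muB _ (f a *: w)) (muB (cutV a f)) muZ; ring.
rewrite sumE muE.
set A := \sum_(x <- s | ~~ lto L x) _ in s2P *; set Q := \sum_(x <- s | q x) _.
have -> : A + g a * f a + Q - (mu (cutL L f) + f a * mu w +
    mu (cutV a f - cutL L f - f a *: w)) =
  (A - mu (cutL L f)) + (f a * (g a - mu w) -
    mu (cutV a f - cutL L f - f a *: w) + Q) by ring.
rewrite (le_trans (ler_normD _ _))// [e]splitr lerD//.
have -> : e / 2 = `|f| * c + M * c + c * `|f| + c.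
  by rewrite [c * `|f|]mulrC -!mulrDl -[X in _ + X]mul1r -mulrDl /c mulrCA divff ?mulr1 ?gt_eqF.
apply: (@le_trans _ _ (`|f| * c + M * c + c * `|f|)); last by rewrite lerDl ltW.
rewrite (le_trans (ler_normD _ _))// lerD//.
  rewrite (le_trans (ler_normB _ _))// lerD//.
    rewrite normrM ler_pM ?fs_le// distrC; exact: L2P.
  rewrite (le_trans (mu_bound _))// ler_wpM2l// fs_norm_le ?ltW// => x.
  rewrite [X in `|X|](_ : _ =
    cutV a f x - cutL L f x - f a * (ind a x - indL L x))//.
  rewrite cutLE indLE cutopE indleE; have [Lx|Lx] := boolP (lto L x).
    rewrite !subr0; have [xa|_] := leP x a.
      by rewrite mulr1 distrC L3P//; exact: leo_lto LL3 Lx.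
    by rewrite mulr0 subr0 normr0 ltW.
  have -> : (x <= a)%O.
    by rewrite leNgt; apply: contra Lx => ax; exact: lto_le La (ltW ax).
  by rewrite !subrr mulr0 subr0 normr0 ltW.
rewrite (le_trans (ler_norm_sum _ _ _))//.
apply: (@le_trans _ _ (\sum_(x <- s | q x) `|g x| * `|f|)).
  by apply: ler_sum => x _; rewrite normrM ler_wpM2l ?fs_le.
rewrite -mulr_suml ler_wpM2r// -big_filter s1P ?filter_uniq// => x.
rewrite mem_filter => /andP[/andP[Lx xa] _]; apply/negP => /L1P.
by move=> /(_ (leo_lto LL1 Lx)); rewrite leNgt xa.
Qed.

Lemma representation_exists : exists h : T -> K,
  (exists N, forall s : seq T, uniq s -> \sum_(x <- s) `|h x| <= N) /\
  forall (f : V) (a : T) (e : K), 0 < e -> exists s0 : seq T, forall s,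
    uniq s -> {subset s0 <= s} ->
    `|\sum_(x <- s | (x <= a)%O) h x * f x - mu (cutV a f)| <= e.
Proof. by exists g; split; [exists (M + 1)|exact: representation_upto]. Qed.

End representation.

(** * The Loy--Willis ideal *)

Section loy_willis.
Variables (R : realType) (k : scalar_kind) (d : Order.disp_t) (W : omega1 d).
Local Notation K := (scalar_field R k).
Local Notation X := (C0_space R k W).
Local Notation Y := (C_space R k W).
Let wo := @omega1_well_ordered d W.
Let wo1 := with_top_well_ordered wo.

Lemma C_continuous (f : with_top W -> K) :
  f \in fs_pred (FunSpace (@C_submod R k d W) (@C_bounded R k d W)) ->
  continuous f.
Proof. by move=> /asboolP. Qed.

Lemma C_cut a (f : with_top W -> K) : continuous f ->
  cutf a f \in fs_pred (FunSpace (@C_submod R k d W) (@C_bounded R k d W)).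
Proof. by move=> fc; apply/asboolP; exact: (cutf_continuous wo1). Qed.

Definition oneC (a : with_top W) : Y := indle C_cut a.

Lemma oneCE a x : oneC a x = if (x <= a)%O then 1 else 0.
Proof. by []. Qed.

Lemma lt_Some (a b : W) : ((Some a : with_top W) < Some b)%O = (a < b)%O.
Proof. by rewrite !ltNge. Qed.

Lemma lt_top (a : W) : ((Some a : with_top W) < None)%O.
Proof. by rewrite ltNge. Qed.

Lemma lto_omap (L : option W) (x : W) :
  @lto _ (with_top W) (omap Some L) (Some x) = lto L x.
Proof. by case: L => //= a; rewrite lt_Some. Qed.

Lemma lto_top (L : option (with_top W)) :
  lto L None -> exists a : W, forall x : W, (a < x)%O -> lto L (Some x).
Proof.
case: L => [[a|]|] /=; last by exists (w0 W).
  by exists a => x; rewrite lt_Some.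
by rewrite ltxx.
Qed.

Lemma C_continuousP (f : Y) x e : 0 < e ->
  exists2 L, lto L x & forall z, (z <= x)%O -> lto L z -> `|f x - f z| <= e.
Proof. by have /asboolP/(continuous_woP wo1) fc := fs_funP f; exact: fc. Qed.

Lemma C_near_top (f : Y) e : 0 < e ->
  exists a : W, forall x, (a < x)%O -> `|f None - f (Some x)| <= e.
Proof.
move=> e0; have [L /lto_top[a aL] LP] := C_continuousP f None e0.
by exists a => x ax; apply: LP => //; exact: aL.
Qed.

Definition extend_fun (f : X) (x : with_top W) : K :=
  if x is Some a then f a else 0.

Lemma extend_C (f : X) : extend_fun f \in
  fs_pred (FunSpace (@C_submod R k d W) (@C_bounded R k d W)).
Proof.
apply/asboolP/(continuous_woP wo1) => -[x|] e e0.
  have [L Lx LP] := C0_continuousP f x e0.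
  exists (omap Some L); first by rewrite lto_omap.
  by move=> [z|//] zx; rewrite lto_omap; exact: LP.
have [a fa] := C0_vanish f; exists (Some (Some a)) => [|[z|] _]; first exact: lt_top.
  by rewrite /= lt_Some => az; rewrite fa// subrr normr0 ltW.
by rewrite subrr normr0 ltW.
Qed.

Lemma extend_linear : linear (fun f : X => FsType (extend_C f) : Y).
Proof.
move=> c f g; apply: fs_ext => -[x|]; first by [].
by rewrite -[RHS]/(c * 0 + 0) mulr0 addr0.
Qed.

Lemma extend_bound (f : X) : `|FsType (extend_C f) : Y| <= 1 * `|f|.
Proof.
rewrite mul1r; apply: fs_norm_le => // -[x|] /=; first exact: fs_le.
by rewrite normr0.
Qed.

Definition extend : bop X Y := mkbop extend_linear extend_bound.
(** Beyond [l n], [f] is within [1/(n+1)] of its value at omega_1, hence equal to it beyond a bound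
    of all [l n]. *)
Lemma recenter_C0 (f : Y) : (fun x : W => f (Some x) - f None) \in
  fs_pred (FunSpace (@C0_submod R k d W) (@C0_bounded R k d W)).
Proof.
apply/asboolP; split.
  apply/(continuous_woP wo) => x e e0.
  have [L Lx LP] := C_continuousP f (Some x) e0.
  have [L' LE] : exists L', L = omap Some L'.
    case: L Lx {LP} => [[a|]|]; [by exists (Some a)| |by exists None].
    by rewrite /= ltNge.
  move: Lx LP; rewrite LE lto_omap => L'x LP; exists L' => // z zx L'z.
  by rewrite opprB addrA subrK LP// lto_omap.
have n0 n : 0 < n.+1%:R^-1 :> K by rewrite invr_gt0 ltr0n.
pose l n := sval (cid (C_near_top f (n0 n))); have lP n := svalP (cid (C_near_top f (n0 n))).
have [b lb] := sequence_bounded l; exists b => x bx.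
rewrite -opprB; apply/eqP; rewrite oppr_eq0; apply/eqP.
apply: small_eq0 => e e0; have [n ne] := scalar_archimedean e0.
by rewrite (le_trans _ (ltW ne))// lP// (lt_trans (lb n)).
Qed.

Lemma recenter_linear : linear (fun f : Y => FsType (recenter_C0 f) : X).
Proof.
move=> c f g; apply: C0_ext => x.
rewrite -[LHS]/(c * f (Some x) + g (Some x) - (c * f None + g None)).
rewrite -[RHS]/(c * (f (Some x) - f None) + (g (Some x) - g None)).
by ring.
Qed.

Lemma recenter_bound (f : Y) : `|FsType (recenter_C0 f) : X| <= 2 * `|f|.
Proof.
apply: fs_norm_le => [|x /=]; first by rewrite mulr_ge0.
by rewrite (le_trans (ler_normB _ _))// mulr_natl mulr2n lerD// fs_le.
Qed.

Definition recenter : bop Y X := mkbop recenter_linear recenter_bound.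

Lemma recenter_extend : bop_comp recenter extend = 1.
Proof. by apply: bop_ext => f; apply: C0_ext => x; rewrite /= subr0. Qed.

Lemma extend_one0 b : extend (one0 R k b) = oneC (Some b).
Proof. by apply: fs_ext => -[x|]. Qed.

Lemma partial_sumE (I : choiceType) (V : zmodType) (x : I -> V) (J : {fset I}) :
  partial_sum x J = \sum_(i <- J) x i.
Proof. by rewrite /partial_sum big_seq_fsetE. Qed.

Lemma sum_fset (I : choiceType) (V : zmodType) (x : I -> V) (s : seq I) :
  uniq s -> \sum_(i <- [fset i in s]%fset) x i = \sum_(i <- s) x i.
Proof.
move=> su; apply: perm_big; apply: uniq_perm => // i.
by rewrite !inE.
Qed.

Lemma totally_Filter : Filter (@totally (with_top W)).
Proof. exact: (@filter_filter _ _ totally_filter). Qed.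

Lemma C_represents (mu : Y -> K) (M : K) : linear mu -> 0 <= M ->
  (forall f, `|mu f| <= M * `|f|) -> exists g, represents g mu.
Proof.
move=> mul M0 muM.
have [g [[N gN] gP]] := representation_exists wo1 C_continuous C_cut mul M0 muM.
exists g; split; first by exists N => J; rewrite partial_sumE; exact: gN (fset_uniq J).
have FF := totally_Filter; move=> f; apply/(@cvgrPdist_le K K) => e e0; have [s0 sP] := gP f None e e0.
exists [fset x in s0]%fset => // J /fsubsetP /= s0J.
have := sP J (fset_uniq J); rewrite distrC partial_sumE.
have -> : cutop C_continuous C_cut None f = f.
  by apply: fs_ext => x; rewrite cutopE; case: x.
have -> : \sum_(x <- J | (x <= None)%O) g x * f x = \sum_(x <- J) g x * f x.
  by apply: eq_bigl => -[].
by apply=> x xs; apply: s0J; rewrite inE.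
Qed.

(** For [b] large, the points of [(b, omega_1)] avoid a finite set carrying almost all of [g], so
    only [g None] matters. *)
Lemma represents_top (mu : Y -> K) g (e : K) : linear mu -> represents g mu -> 0 < e ->
  exists a, forall b : W, (a < b)%O ->
    `|mu (oneC None - oneC (Some b)) - g None| <= e.
Proof.
move=> mul [[N gN] gP] e0; have e2 : 0 < e / 2 by rewrite divr_gt0.
have gN' (s : seq (with_top W)) : uniq s -> \sum_(i <- s) `|g i| <= N.
  by move=> su; have := gN [fset i in s]%fset; rewrite partial_sumE sum_fset.
have [s1 s1P] := small_tail gN' e2.
have [L L0 LP] := @last_point_below _ (with_top W) s1 None.
have [a aL] := lto_top L0; exists a => b ab.
set f := oneC None - oneC (Some b).
have fE z : f z = if ((Some b : with_top W) < z)%O then 1 else 0.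
  rewrite [LHS](_ : _ = oneC None z - oneC (Some b) z)// !oneCE.
  have -> : (z <= (None : with_top W))%O by case: z.
  by rewrite leNgt; case: (_ < _)%O; rewrite /= ?subr0 ?subrr.
have FF := totally_Filter; have /(@cvgrPdist_le K K)/(_ _ e2)[A _ AP] := gP f.
have := AP (None |` A)%fset; rewrite /= partial_sumE => /(_ (fsubsetU1 _ _)) fA.
rewrite [mu f - _](_ : _ = (mu f - \sum_(z <- (None |` A)%fset) g z * f z) +
  (\sum_(z <- (None |` A)%fset) g z * f z - g None)); last by ring.
rewrite (le_trans (ler_normD _ _))// [e]splitr lerD//.
rewrite (bigD1_seq None) ?fset_uniq ?fset1U1// fE lt_top mulr1 addrC addKr.
rewrite (le_trans (ler_norm_sum _ _ _))//.
apply: (@le_trans _ _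
    (\sum_(z <- (None |` A)%fset | (z != None) && ((Some b : with_top W) < z)%O) `|g z|)).
  rewrite big_mkcondr; apply: ler_sum => z _; rewrite fE.
  by case: ifP => _; rewrite ?mulr1// mulr0 normr0.
rewrite -big_filter s1P ?filter_uniq ?fset_uniq// => z.
rewrite mem_filter => /andP[/andP[zN bz] _]; apply/negP => /LP.
case: z zN bz => // z _; rewrite lt_Some => bz.
by move=> /(_ (aL _ (lt_trans ab bz))).
Qed.

Lemma op_matrix_represents (S : 'B(Y)) b :
  represents (op_matrix S b) (point_eval b \o S).
Proof.
have [|||g gP] := @C_represents (point_eval b \o S) (op_norm S).
- by move=> c f g; rewrite /= linearP.
- exact: op_norm_ge0.
- by move=> f; apply: le_trans (op_norm_ge S f); exact: fs_le.
have : exists h, [set h | represents h (point_eval b \o S)] h by exists g.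
exact: xgetPex.
Qed.

(** At [x] in [D], [c] is the difference between the values of [S (oneC (Some b))] at [x] and at
    omega_1. Replacing [oneC (Some b)] by [oneC None] costs nearly the last entries of the two rows,
    which are close by hypothesis; continuity of [S (oneC None)] does the rest. Each of the four
    errors is at most [e]. *)
Lemma original_loy_willis_recenter (S : 'B(Y)) :
  original_loy_willis_ideal S ->
  is_alspach_benyamini (bop_comp recenter (bop_comp S extend)) 0.
Proof.
move=> Sc; set T := bop_comp _ _.
have [c Tc] := alspach_benyamini_exists T; suff <- : c = 0 by [].
have [D Dc DT] := Tc; apply: (@small_mul_eq0 R k 4) => // e e0.
have [a1 a1P] := C_near_top (S (oneC None)) e0.
have /(@cvgrPdist_le K K)/(_ _ e0)/(nbhs_wo wo1)[L /lto_top[a2 a2L] LP] := Sc.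
have [x Dx] := club_gt Dc (Order.max a1 a2); rewrite gt_max => /andP[xa1 xa2].
have row_lin b : linear (point_eval b \o S).
  by move=> u f g; rewrite /= linearP.
have [a3 a3P] := represents_top (row_lin None) (op_matrix_represents S None) e0.
have [a4 a4P] := represents_top (row_lin (Some x)) (op_matrix_represents S (Some x)) e0.
(* [b] is chosen after [x] because [a4] depends on the row of [x]. *)
have [b] := exists_gt (Order.max x (Order.max a3 a4)).
rewrite !gt_max => /and3P[xb /a3P top_b /a4P x_b].
have cE : c = S (oneC (Some b)) (Some x) - S (oneC (Some b)) None.
  have := DT (one0 R k b) x Dx; rewrite one0E (ltW xb) mulr1 => <-.
  by rewrite -extend_one0.
have /a1P one_x := xa1.
have Gx : `|op_matrix S None None - op_matrix S (Some x) None| <= e.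
  by apply: LP => //; exact: a2L.
move: top_b x_b; rewrite /= /point_eval !linearB => top_b x_b.
set G0 := op_matrix S None None in top_b Gx.
set G1 := op_matrix S (Some x) None in x_b Gx.
have -> : c = (S (oneC None) None - S (oneC (Some b)) None - G0)
   - (S (oneC None) (Some x) - S (oneC (Some b)) (Some x) - G1)
   - (S (oneC None) None - S (oneC None) (Some x)) + (G0 - G1).
  by rewrite cE; ring.
have -> : 4 * e = e + e + e + e by ring.
rewrite (le_trans (ler_normD _ _))// lerD//.
rewrite (le_trans (ler_normB _ _))// lerD//.
by rewrite (le_trans (ler_normB _ _))// lerD.
Qed.

(** Since [A * B = 1], multiplicativity shows that the character takes the same value at [T] and at
    [A * T * B], where it is 0 by the preceding lemma. *)
Lemma loy_willis_alspach_benyamini (T : 'B(X)) :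
  loy_willis_ideal T -> is_alspach_benyamini T 0.
Proof.
move=> [U [V [VU _ /original_loy_willis_recenter S0]]].
pose A : 'B(X) := bop_comp recenter V; pose B : 'B(X) := bop_comp U extend.
have AB : A * B = 1.
  rewrite -recenter_extend; apply: bop_ext => f /=.
  have := congr1 (fun S : 'B(Y) => S (extend f)) VU.
  by move=> /= ->.
have : alspach_benyamini (A * T * B) = 0.
  by apply: alspach_benyaminiE; exact: S0.
rewrite !alspach_benyaminiM mulrAC -alspach_benyaminiM AB alspach_benyamini1.
rewrite mul1r => <-; exact: alspach_benyaminiP.
Qed.

End loy_willis.

(** * Traces as multiples of the character, and their continuity *)

Theorem corollary1p13 (R : realType) (k : scalar_kind)
    (d : Order.disp_t) (W : omega1 d) :
  (forall T : 'B(C0_space R k W), loy_willis_ideal T ->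
     exists2 n : nat, (n <= 3)%N &
       exists A B : 'I_n -> 'B(C0_space R k W),
         T = \sum_(i < n) commutator (A i) (B i))
  /\ (forall tau : {scalar 'B(C0_space R k W)},
        is_trace tau <->
        exists c : scalar_field R k,
          forall T, tau T = c * alspach_benyamini T)
  /\ (forall tau : {scalar 'B(C0_space R k W)},
        is_trace tau -> continuous tau).
Proof.
have trace_form (tau : {scalar 'B(C0_space R k W)}) : is_trace tau ->
    exists c : scalar_field R k, forall T, tau T = c * alspach_benyamini T.
  (* The character is 1 at the identity, which forces the constant; [T - c *: 1] lies in its kernel
     and so is a sum of commutators, killed by [tau]. *)
  move=> tr; exists (tau 1) => T; set c := alspach_benyamini T.
  have [|A1 [B1 [A2 [B2 TE]]]] := @kernel_commutators R k d W (T - c *: (1 : 'B(C0_space R k W))).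
    have [D Dc DT] := alspach_benyaminiP T; exists D => // f a Da.
    by rewrite mul0r -[LHS]/(T f a - c * f a) DT// subrr.
  have : tau (T - c *: (1 : 'B(C0_space R k W))) = 0.
    by rewrite TE linearD !linearB /= !(tr A1, tr A2) !subrr addr0.
  by rewrite linearB linearZ /= => /eqP; rewrite subr_eq0 => /eqP ->; rewrite mulrC.
split=> [T /loy_willis_alspach_benyamini/kernel_commutators|].
  move=> [A1 [B1 [A2 [B2 TE]]]]; exists 2%N => //.
  exists (fun i => if i == ord0 then A1 else A2), (fun i => if i == ord0 then B1 else B2).
  by rewrite !big_ord_recl big_ord0 addr0.
split=> tau.
  split=> [|[c tauE] S T]; first exact: trace_form.
  by rewrite !tauE !alspach_benyaminiM [X in _ * X]mulrC.
move=> /trace_form[c tauE].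
apply/(@linear_bounded_continuous _ 'B(C0_space R k W) (scalar_field R k)^o tau).
apply/(@linear_boundedP _ 'B(C0_space R k W) (scalar_field R k)^o tau).
(* The character is bounded by the operator norm, so [tau] is bounded by [|c|] times it. *)
exists `|c|; split=> [|r cr T]; first exact: normr_real.
rewrite tauE normrM; apply: ler_pM => //; first exact: ltW.
exact: alspach_benyamini_norm.
Qed.
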